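(* Let $j,r\ge 0$ and $k\ge 1$ be integers with $j+r\le k$. Then \[ \sum_{s_1\ge\cdots\ge s_k\ge 0}\frac{q^{s_1^2+\cdots+s_k^2-s_1-\cdots-s_j+\sum_{i=k-r+1}^{k}s_i+s_k}}{(q)_{s_1-s_2}\cdots(q)_{s_{k-1}-s_k}(q^2;q^2)_{s_k}} =\frac{1}{1+q}\sum_{s=0}^{j}\left(\frac{(q^{2k+2},q^{k+2-r+j-2s},q^{k+r-j+2s};q^{2k+2})_\infty}{(q)_\infty}+q\,\frac{(q^{2k+2},q^{k-r+j-2s},q^{k+2+r-j+2s};q^{2k+2})_\infty}{(q)_\infty}\right). \] (The exponent $\sum_{i=k-r+1}^k s_i+s_k$ is the paper's $s_{k-r+1}+\cdots+s_{k-1}+2s_k$.)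
   Context: $q$ is a complex number with $|q|<1$. $(a;q)_\infty=\prod_{m\ge0}(1-aq^m)$, $(a;q)_n=(a;q)_\infty/(aq^n;q)_\infty$, $(a)_n=(a;q)_n$, $(a_1,\dots,a_m;q)_\infty=(a_1;q)_\infty\cdots(a_m;q)_\infty$. Empty sums equal $0$. *)

(* Defs.v *)
From HB Require Import structures.
From mathcomp Require Import all_boot all_order all_algebra complex.
From mathcomp Require Import all_classical all_reals all_analysis.
From mathcomp.analysis.showcase Require Import summability.

Set Implicit Arguments.
Unset Strict Implicit.
Unset Printing Implicit Defensive.

Import Order.TTheory GRing.Theory Num.Theory.
Import numFieldNormedType.Exports.

Local Open Scope classical_set_scope.
Local Open Scope ring_scope.

(* The libraries leave R[i] without a topology: give it the one of its norm,
   which every numFieldType K carries on K^o. *)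
HB.instance Definition _ (R : realType) :=
  PseudoPointedMetric.copy R[i] (R[i] : numFieldType)^o.

Section QSeries.
Variable R : realType.
Implicit Types (a q : R[i]).

(* (a;q)_oo; the products converge when |q| < 1 *)
Definition qpoch_inf a q : R[i] :=
  lim ((fun n => \prod_(m < n) (1 - a * q ^+ m)) @ \oo).

(* (a_1,...,a_m;q)_oo *)
Definition qpoch_infs (s : seq R[i]) q : R[i] :=
  \prod_(a <- s) qpoch_inf a q.

(* (a;q)_n *)
Definition qpoch a q n : R[i] := qpoch_inf a q / qpoch_inf (a * q ^+ n) q.

End QSeries.

Section Chains.
Variable k : nat.

(* s_1 >= ... >= s_k >= 0 *)
Definition chain : Type := {s : k.-tuple nat | sorted geq s}.

(* s_i, with i counted from 1 *)
Definition entry (s : chain) (i : nat) : nat := nth 0%N (val s) i.-1.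

(* s_1^2 + ... + s_k^2 + (s_(k-r+1) + ... + s_k) + s_k - (s_1 + ... + s_j);
   the subtraction of naturals does not truncate when j <= k, as s_i <= s_i^2 *)
Definition exponent (j r : nat) (s : chain) : nat :=
  (\sum_(1 <= i < k.+1) entry s i ^ 2
   + \sum_((k - r).+1 <= i < k.+1) entry s i + entry s k
   - \sum_(1 <= i < j.+1) entry s i)%N.

Definition chain_term (R : realType) (q : R[i]) (j r : nat) (s : chain) : R[i] :=
  q ^+ exponent j r s /
  (\prod_(1 <= i < k) qpoch q q (entry s i - entry s i.+1)
   * qpoch (q ^+ 2) (q ^+ 2) (entry s k)).

End Chains.

(* Main.v *)
(** Summing a chain from its innermost index outwards applies, for each index, an operator
    Z |-> (n |-> sum_s q^(s^2 + e s) Z(s) / (q)_(n-s)) with e in {-1, 0, 1}.  By the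
    q-Vandermonde sum these operators are diagonal on the Bailey kernels
    1 / ((q)_(n-m) (q)_(n+m+e)), attached to the parameter a = q^e.
    A telescoping identity expands the innermost factor q^n / (q^2;q^2)_n in the kernels
    a = q; the r inner operators act there, and the factor 1 - q^(4m+2) of the coefficients
    is what allows one to pass to the kernels a = 1 without a division.  On the span of the
    kernels a = 1 and a = 1/q the j outer operators are triangular, with eigenvalues
    q^(m^2 + m) and q^(m^2 - m): their powers produce the sum over s = 0, ..., j.  When the
    bound on s_1 tends to infinity every kernel tends to 1 / (q)_oo^2, and what is left is a
    combination of partial theta sums over m >= 0 which Jacobi's triple product evaluates.
    All exponents of q are kept natural, so that q = 0 is not special. *)

Require Import Defs.
From mathcomp Require Import all_boot all_order all_algebra complex.
From mathcomp Require Import all_classical all_reals all_analysis.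
From mathcomp.analysis.showcase Require Import summability.
From mathcomp Require Import finmap ring lra zify.

Import Order.TTheory GRing.Theory Num.Theory.
Import numFieldNormedType.Exports.

Local Open Scope classical_set_scope.
Local Open Scope ring_scope.

(** * Bailey kernels *)

Section Kernels.
Variables (F : fieldType) (q : F).

(* 1 / (q;q)_n *)
Definition iqpoch (n : nat) : F := \prod_(i < n) (1 - q ^+ i.+1)^-1.

(* The Bailey kernels in n attached to a = 1, a = q and a = 1/q, extended by 0 for n < m. *)
Definition kerA1 (m n : nat) : F :=
  if (m <= n)%N then iqpoch (n - m) * iqpoch (n + m) else 0.

Definition kerAq (m n : nat) : F :=
  if (m <= n)%N then iqpoch (n - m) * iqpoch (n + m).+1 else 0.

(* 1 / ((q)_(n-m) (q)_(n+m-1)), where n = m = 0 gives 1 / (q)_(-1) = 0. *)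
Definition kerAqV (m n : nat) : F := (1 - q ^+ (n + m)) * kerA1 m n.

(** Summation over one chain index [s], bounded by the preceding index [n]. The weight [w] stays
    arbitrary so that linearity is proved once for all three exponents. *)
Definition level (w Z : nat -> F) (n : nat) : F :=
  \sum_(s < n.+1) w s * iqpoch (n - s) * Z s.

Lemma eq_level (w Z Z' : nat -> F) (n : nat) :
  (forall s, (s <= n)%N -> Z s = Z' s) -> level w Z n = level w Z' n.
Proof.
by move=> eZ; apply: eq_bigr => s _; rewrite eZ // -ltnS.
Qed.

Lemma level_sum (w : nat -> F) (I : Type) (r : seq I) (a : I -> F)
    (Z : I -> nat -> F) (n : nat) :
  level w (fun s => \sum_(i <- r) a i * Z i s) n =
  \sum_(i <- r) a i * level w (Z i) n.
Proof.
rewrite /level.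
under eq_bigr do rewrite mulr_sumr.
rewrite exchange_big; apply: eq_bigr => i _; rewrite mulr_sumr.
by apply: eq_bigr => s _; rewrite mulrCA.
Qed.

Lemma level_scale (w : nat -> F) (a : F) (Z : nat -> F) (n : nat) :
  level w (fun s => a * Z s) n = a * level w Z n.
Proof. by rewrite /level mulr_sumr; apply: eq_bigr => s _; rewrite mulrCA. Qed.

Lemma level_lin (w : nat -> F) (a b : F) (Y Z : nat -> F) (n : nat) :
  level w (fun s => a * Y s + b * Z s) n = a * level w Y n + b * level w Z n.
Proof.
rewrite /level !mulr_sumr -big_split; apply: eq_bigr => s _ /=; ring.
Qed.

Hypothesis q_neq : forall n : nat, 1 - q ^+ n.+1 != 0.

Lemma iqpoch0 : iqpoch 0 = 1.
Proof. exact: big_ord0. Qed.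

Lemma iqpochS n : (1 - q ^+ n.+1) * iqpoch n.+1 = iqpoch n.
Proof. by rewrite /iqpoch big_ord_recr /= mulrC mulfVK. Qed.

(** The q-Vandermonde sum with one parameter sent to infinity. The induction on [L] keeps [M] free:
    multiplied by 1 - q^(L+1), the sum for [L.+1] becomes the one for (L, M) plus q^(L+M+1) times
    the one for (L, M+1). *)
Lemma qVandermonde (L M : nat) :
  \sum_(t < L.+1) q ^+ (t * t + M * t) * iqpoch (L - t) * iqpoch t * iqpoch (t + M)
  = iqpoch L * iqpoch (L + M).
Proof.
elim: L M => [|L IH] M.
  by rewrite big_ord1 /= !muln0 expr0 iqpoch0 !mul1r add0n.
(* Split 1 - q^(L+1) = (1 - q^(L+1-t)) + q^(L+1-t) (1 - q^t) in each term. *)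
apply: (mulfI (q_neq L)); rewrite mulr_sumr.
rewrite (eq_bigr (fun t : 'I_L.+2 =>
    q ^+ (t * t + M * t) * ((1 - q ^+ (L.+1 - t)) * iqpoch (L.+1 - t)) * iqpoch t * iqpoch (t + M)
  + q ^+ (t * t + M * t + (L.+1 - t)) * iqpoch (L.+1 - t) * ((1 - q ^+ t) * iqpoch t) * iqpoch (t + M))); last first.
  move=> t _; have -> : q ^+ L.+1 = q ^+ (L.+1 - t) * q ^+ t.
    by rewrite -exprD subnK // -ltnS.
  rewrite [in q ^+ (_ + (_ - _))]exprD; ring.
rewrite big_split /=; rewrite [X in X + _]big_ord_recr [X in _ + X]big_ord_recl /=.
rewrite subnn expr0 subrr !(mul0r, mulr0) addr0 add0r.
under eq_bigr => i _.
  rewrite subSn ?iqpochS; last by rewrite -ltnS.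
  over.
rewrite IH.
under [X in _ + X]eq_bigr => i _.
  rewrite /bump /= add1n iqpochS subSS.
  have -> : (i.+1 * i.+1 + M * i.+1 + (L - i) = (M + L).+1 + (i * i + M.+1 * i))%N.
    by have := ltn_ord i; lia.
  rewrite exprD [(i.+1 + M)%N]addSnnS -!mulrA.
  over.
rewrite -mulr_sumr.
under eq_bigr do rewrite !mulrA.
rewrite IH addnS [RHS]mulrA iqpochS addSn -(iqpochS (L + M)) [(M + L)%N]addnC; ring.
Qed.

Lemma sum_ord_from (m n : nat) (G : nat -> F) : (m <= n)%N ->
  \sum_(s < n.+1) (if (m <= s)%N then G s else 0) =
  \sum_(t < (n - m).+1) G (m + t)%N.
Proof.
move=> le_mn.
rewrite -(big_mkord predT (fun s => if (m <= s)%N then G s else 0)).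
rewrite (big_cat_nat _ (n := m)) ?leqW //=.
rewrite big_nat big1 ?add0r => [|s /andP[_ lt_sm]]; last by rewrite leqNgt lt_sm.
rewrite -{1}(add0n m) big_addn -subSn // big_mkord; apply: eq_bigr => t _.
by rewrite leq_addl addnC.
Qed.

(** The substitution s = m + t turns the level into [qVandermonde] with L = n - m; [c] is the
    exponent of the weight at s = m and so gives the eigenvalue. *)
Lemma level_ker (M c m n : nat) (w : nat -> nat) (K : nat -> F) :
    (forall t, w (m + t)%N = c + (t * t + M * t))%N ->
    (forall s, (s < m)%N -> K s = 0) ->
    (forall t, K (m + t)%N = iqpoch t * iqpoch (t + M)) ->
  level (fun s => q ^+ w s) K n = q ^+ c * K n.
Proof.
move=> ew K0 Km; have [lt_nm|le_mn] := ltnP n m.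
  rewrite K0 // mulr0; apply: big1 => s _.
  by rewrite K0 ?mulr0 // (leq_trans (ltn_ord s)).
rewrite -{2}(subnKC le_mn) Km -qVandermonde mulr_sumr.
pose G s := q ^+ w s * iqpoch (n - s) * K s.
transitivity (\sum_(t < (n - m).+1) G (m + t)%N).
  rewrite -sum_ord_from //; apply: eq_bigr => s _; case: leqP => // lt_sm.
  by rewrite K0 ?mulr0.
by apply: eq_bigr => t _; rewrite /G Km ew exprD subnDA; ring.
Qed.

Lemma level_kerAq (m n : nat) :
  level (fun s => q ^+ (s * s.+1)) (kerAq m) n = q ^+ (m * m.+1) * kerAq m n.
Proof.
apply: (level_ker (m + m).+1 (m * m.+1) m) => [t|s lt_sm|t]; first by lia.
  by rewrite /kerAq leqNgt lt_sm.
by rewrite /kerAq leq_addr addKn; congr (_ * iqpoch _); lia.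
Qed.

Lemma level_kerA1 (m n : nat) :
  level (fun s => q ^+ (s * s)) (kerA1 m) n = q ^+ (m * m) * kerA1 m n.
Proof.
apply: (level_ker (m + m) (m * m) m) => [t|s lt_sm|t]; first by lia.
  by rewrite /kerA1 leqNgt lt_sm.
by rewrite /kerA1 leq_addr addKn; congr (_ * iqpoch _); lia.
Qed.

(** Both sides are 1 / ((q)_n (q)_(n-1)), read as 0 at n = 0. This reduces m = 0, where 2m - 1 is
    not natural, to m = 1. *)
Lemma kerAqV0 (n : nat) : kerAqV 0 n = kerAqV 1 n.
Proof.
rewrite /kerAqV /kerA1; case: n => [|n]; first by rewrite expr0 subrr !mul0r mulr0.
by rewrite leq0n subn0 addn0 mulrA iqpochS addn1 mulrCA iqpochS subSS subn0 mulrC.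
Qed.

Lemma level_kerAqV (m n : nat) :
  level (fun s => q ^+ (s * s.-1)) (kerAqV m) n = q ^+ (m * m.-1) * kerAqV m n.
Proof.
(* For m = p + 1 the factor 1 - q^(n+m) cancels against 1 / (q)_(n+m), which leaves the shift M = 2p
   + 1. *)
have pos p : level (fun s => q ^+ (s * s.-1)) (kerAqV p.+1) n =
    q ^+ (p.+1 * p) * kerAqV p.+1 n.
  apply: (level_ker (p + p).+1 (p.+1 * p) p.+1) => [t|s lt_sp|t]; first by rewrite addSn /=; nia.
    by rewrite /kerAqV /kerA1 leqNgt lt_sp mulr0.
  rewrite /kerAqV /kerA1 leq_addr addKn !addSn mulrCA iqpochS.
  by congr (_ * iqpoch _); lia.
case: m => [|p]; last exact: pos.
rewrite kerAqV0 -(pos 0%N).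
by apply: eq_level => s _; exact: kerAqV0.
Qed.

(** Multiplying [kerA1] = [kerAqV] + q^(s+m) [kerA1] by q^(s^2-s) gives the weight q^(s^2-s) on
    [kerAqV] and q^m q^(s^2) on [kerA1]; each kernel is an eigenvector for the weight it
    receives. *)
Lemma level_kerA1_AqV (m n : nat) :
  level (fun s => q ^+ (s * s.-1)) (kerA1 m) n =
  q ^+ (m * m.+1) * kerA1 m n + q ^+ (m * m.-1) * kerAqV m n.
Proof.
rewrite -level_kerAqV [in q ^+ _ * _]mulnS exprD -mulrA -level_kerA1.
rewrite /level mulr_sumr -big_split; apply: eq_bigr => s _ /=.
rewrite /kerAqV.
have -> : q ^+ (s * s) = q ^+ (s * s.-1) * q ^+ s.
  by rewrite -exprD; congr (_ ^+ _); case: (nat_of_ord s) => //= p; nia.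
rewrite [q ^+ (s + m)]exprD; ring.
Qed.

(** With x = q^(2m+1), cancel 1 + x from 1 - x^2. Over the common denominator (q)_(n-m) (q)_(n+m+1)
    the claim is (1 - q^(n+m+1)) - x (1 - q^(n-m)) = 1 - x. *)
Lemma kerAq_A1 (m n : nat) :
  (1 - q ^+ (4 * m + 2)) * kerAq m n =
  (1 + q ^+ (2 * m).+1) * (kerA1 m n - q ^+ (2 * m).+1 * kerA1 m.+1 n).
Proof.
have -> : (4 * m + 2 = (2 * m).+1 + (2 * m).+1)%N by lia.
rewrite exprD; set x := q ^+ _.
have -> : 1 - x * x = (1 + x) * (1 - x) by ring.
rewrite -mulrA; congr (_ * _); rewrite /kerAq /kerA1.
case: (ltngtP m n) => [lt_mn|lt_nm|<-].
- rewrite addnS -(iqpochS (n + m)).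
  have -> : (n - m = (n - m.+1).+1)%N by lia.
  rewrite -(iqpochS (n - m.+1)) /x.
  have -> : ((n + m).+1 = (2 * m).+1 + (n - m.+1).+1)%N by lia.
  rewrite exprD; ring.
- by rewrite !mulr0 subr0.
- rewrite mulr0 subr0 subnn -(iqpochS (m + m)) /x mul2n addnn; ring.
Qed.

End Kernels.

Arguments iqpoch {F} q n.
Arguments kerA1 {F} q m n.
Arguments kerAq {F} q m n.
Arguments kerAqV {F} q m n.
Arguments level {F} q w Z n.
Arguments level_sum {F q}.
Arguments level_lin {F q}.
Arguments eq_level {F q}.
Arguments iqpochS {F q}.
Arguments level_kerAq {F q}.
Arguments level_kerA1 {F q}.
Arguments level_kerAqV {F q}.
Arguments level_kerA1_AqV {F q}.
Arguments kerAq_A1 {F q}.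
Arguments level_scale {F q}.

(** * Expansion of the innermost factor in the kernels a = q *)

Section Finite.
Variables (F : fieldType) (q : F).
Hypothesis q_neq : forall n : nat, 1 - q ^+ n.+1 != 0.

Definition seed (n : nat) : F := q ^+ n * iqpoch (q ^+ 2) n.

(** Up to a factor independent of m, the alpha-sequence of a Bailey pair relative to a = q whose
    beta-sequence is [seed]. *)
Definition seed_coef (m : nat) : F :=
  (-1) ^+ m * q ^+ (m * m.-1) * (1 - q ^+ (4 * m + 2)).

(* Found by solving for a Laurent polynomial in q^m; it vanishes at m = 0 and m = n + 2. *)
Let cert (n m : nat) : F := if (m <= n.+1)%N then
   - ((-1) ^+ m * q ^+ (m * m.-1) *
      (q ^+ (n.+2 - m) * (1 - q ^+ (4 * m)) + (1 - q) * (1 - q ^+ (2 * m))) *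
      iqpoch q (n.+1 - m) * iqpoch q (n + m).+1) else 0.

(** Creative telescoping: each summand obeys the recurrence (1 - q^(2n+2)) f(n+1) = q f(n) of [seed]
    up to a difference in m. *)
Lemma seed_telescope (n m : nat) : (m <= n.+1)%N ->
  (1 - q ^+ (2 * n.+1)) * (seed_coef m * kerAq q m n.+1)
    - q * (seed_coef m * kerAq q m n) = cert n m.+1 - cert n m.
Proof.
(* At m = n + 1 both the kernel at n and [cert n m.+1] vanish, so this endpoint is treated apart. *)
rewrite leq_eqVlt => /predU1P[->|lt]; rewrite /cert /seed_coef /kerAq.
  rewrite !ltnn !leqnn !mulr0 subr0 sub0r opprK subnn subSS subSnn expr1.
  rewrite addSn -(iqpochS q_neq (n + n.+1).+1).
  have -> : ((n + n.+1).+2 = (2 * n.+1).+1)%N by lia.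
  have -> : (4 * n.+1 = 2 * n.+1 + 2 * n.+1)%N by lia.
  rewrite ![q ^+ (_ + _)]exprD [q ^+ (2 * _).+1]exprS; set z := q ^+ (2 * _); ring.
move: lt => /[!ltnS] le_mn; rewrite le_mn leqW //=.
rewrite addSn (addnS n m) -(iqpochS q_neq (n + m).+1) !subSS subSn // -(iqpochS q_neq (n - m)).
rewrite (_ : (n.+2 - m = (n - m).+2)%N); last by lia.
have -> : (m.+1 * m = m * m.-1 + 2 * m)%N by case: (m) => //= p; lia.
have -> : ((n + m).+2 = (n - m) + 2 * m + 2)%N by lia.
have -> : (2 * n.+1 = (n - m) + (n - m) + 2 * m + 2)%N by lia.
have -> : (4 * m.+1 = 2 * m + 2 * m + 4)%N by lia.
have -> : (2 * m.+1 = 2 * m + 2)%N by lia.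
have -> : (4 * m = 2 * m + 2 * m)%N by lia.
rewrite !exprS !exprD.
(* Beside common factors only powers of [D], [X] and [q] remain, so the identity is polynomial. *)
set D := q ^+ (n - m); set X := q ^+ (2 * m); ring.
Qed.

(** Both sides satisfy the same first-order recurrence in n, as the differences of [cert] sum to 0,
    and they agree at n = 0. *)
Lemma seed_sum (n : nat) :
  (1 + q) * seed n = \sum_(m < n.+1) seed_coef m * kerAq q m n.
Proof.
have q2_neq m : 1 - (q ^+ 2) ^+ m.+1 != 0.
  by rewrite -exprM mulnS; exact: q_neq.
elim: n => [|n IH].
  rewrite big_ord1 /seed /seed_coef /kerAq /= !iqpoch0.
  rewrite mul0n mul1r !expr0 !mul1r mulr1.
  rewrite -[iqpoch q 0.+1]mul1r -[X in _ * (X * _)](mulVf (q_neq 0)) -mulrA.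
  rewrite iqpochS // iqpoch0 add0n mulr1 expr2 expr1.
  have : 1 - q != 0 by exact: (q_neq 0).
  by move=> ?; field.
have zero : kerAq q n.+1 n = 0 by rewrite /kerAq ltnn.
apply: (mulfI (q2_neq n)).
have -> : (1 - (q ^+ 2) ^+ n.+1) * ((1 + q) * seed n.+1) = q * ((1 + q) * seed n).
  rewrite /seed -(iqpochS q2_neq n) [q ^+ n.+1]exprS; set z := _ ^+ n.+1; ring.
rewrite IH -[in RHS]exprM.
(* The added term m = n + 1 is zero; it gives both sums the range of the telescoping. *)
transitivity (q * \sum_(m < n.+2) seed_coef m * kerAq q m n).
  by rewrite [in RHS]big_ord_recr /= zero mulr0 addr0.
apply/eqP; rewrite eq_sym -subr_eq0 !mulr_sumr -sumrB; apply/eqP.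
rewrite (eq_bigr (fun m : 'I_n.+2 => cert n m.+1 - cert n m)); last first.
  by move=> m _; rewrite seed_telescope // -ltnS.
rewrite -(big_mkord predT (fun m => cert n m.+1 - cert n m)) telescope_sumr //.
by rewrite /cert ltnn muln0 subrr !mulr0 addr0 !(mulr0, mul0r) oppr0 subrr.
Qed.

End Finite.
Arguments seed {F} q n.
Arguments seed_coef {F} q m.
Arguments seed_sum {F q}.

(** * Powers of the level operators on the kernels *)

Section Iterate.
Variables (F : fieldType) (q : F).
Hypothesis q_neq : forall n : nat, 1 - q ^+ n.+1 != 0.

Lemma eq_iter_level (w Z Z' : nat -> F) (j n : nat) :
  (forall s, (s <= n)%N -> Z s = Z' s) ->
  iter j (level q w) Z n = iter j (level q w) Z' n.
Proof.
elim: j n => [|j IH] n eZ; first exact: eZ.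
by apply: eq_level => s le_sn; apply: IH => t le_ts; apply: eZ; apply: leq_trans le_sn.
Qed.

Lemma iter_level_sum (w : nat -> F) (I : Type) (r : seq I) (a : I -> F)
    (Z : I -> nat -> F) (j n : nat) :
  iter j (level q w) (fun s => \sum_(i <- r) a i * Z i s) n =
  \sum_(i <- r) a i * iter j (level q w) (Z i) n.
Proof.
elim: j n => [//|j IH] n /=; rewrite -level_sum.
by apply: eq_level => s _; exact: IH.
Qed.

Lemma iter_level_lin (w : nat -> F) (a b : F) (Y Z : nat -> F) (j n : nat) :
  iter j (level q w) (fun s => a * Y s + b * Z s) n =
  a * iter j (level q w) Y n + b * iter j (level q w) Z n.
Proof.
elim: j n => [//|j IH] n /=; rewrite -level_lin.
by apply: eq_level => s _; exact: IH.
Qed.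

Lemma iter_level_eigen (w Z : nat -> F) (c : F) (j n : nat) :
  (forall n, level q w Z n = c * Z n) ->
  iter j (level q w) Z n = c ^+ j * Z n.
Proof.
move=> eig; elim: j n => [|j IH] n; first by rewrite mul1r.
rewrite iterS; rewrite (eq_level w _ (fun s => c ^+ j * Z s)) => [|s _]; last exact: IH.
by rewrite level_scale eig mulrA -exprSr.
Qed.

(** The subtraction never truncates: s + 1 <= j, and m^2 + m >= 2m. *)
Definition kerAqV_iter (j m n : nat) : F :=
  q ^+ (j * (m * m.+1)) * kerA1 q m n +
  \sum_(s < j) q ^+ (j * (m * m.+1) - 2 * (s.+1 * m)) * kerAqV q m n.

(** The j-th power of a triangular 2 by 2 matrix with eigenvalues u = q^(m^2+m) and v = q^(m^2-m)
    and off-diagonal entry v. Its off-diagonal entry is the sum of u^(j-1-s) v^(s+1), and v = u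
    q^(-2m). *)
Lemma iter_level_kerA1_AqV (j m n : nat) :
  iter j (level q (fun s => q ^+ (s * s.-1))) (kerA1 q m) n = kerAqV_iter j m n.
Proof.
elim: j n => [|j IH] n; first by rewrite /kerAqV_iter big_ord0 mul1r addr0.
have IH' s : iter j (level q (fun s => q ^+ (s * s.-1))) (kerA1 q m) s =
    q ^+ (j * (m * m.+1)) * kerA1 q m s +
    (\sum_(s < j) q ^+ (j * (m * m.+1) - 2 * (s.+1 * m))) * kerAqV q m s.
  by rewrite IH /kerAqV_iter mulr_suml.
rewrite iterS (eq_level _ _ _ n (fun s _ => IH' s)).
rewrite level_lin level_kerA1_AqV // level_kerAqV // /kerAqV_iter.
rewrite mulrDr mulrA -exprD -addrA mulSnr; congr (_ + _).
(* The new term s = 0 is u^j v; multiplication by v shifts every older term from s to s + 1. *)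
rewrite big_ord_recl /= mulrA -exprD; congr (_ * _ + _).
  by congr (q ^+ _); case: (m) => [|p] /=; lia.
rewrite !mulr_suml; apply: eq_bigr => s _; rewrite mulrA -exprD.
congr (q ^+ _ * _); rewrite /bump /=.
have : (s.+1 * m <= j * m)%N by rewrite leq_mul2r ltn_ord orbT.
by case: (m) => [|p] /= ?; nia.
Qed.

(** The coefficient left after the r inner levels, once [kerAq_A1] has traded 1 - q^(4m+2) for 1 +
    q^(2m+1). *)
Definition pair_coef (r m : nat) : F :=
  (1 + q)^-1 * ((-1) ^+ m * q ^+ (m * m.-1 + r * (m * m.+1)) * (1 + q ^+ (2 * m).+1)).

(** Any [N] above [n] will do, since the kernels vanish for m > n; a fixed [N] lets one expansion
    serve all s <= n. *)
Lemma iter_seed (j p r N n : nat) : 1 + q != 0 -> (n < N)%N ->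
  iter j (level q (fun s => q ^+ (s * s.-1)))
    (iter p (level q (fun s => q ^+ (s * s)))
      (iter r (level q (fun s => q ^+ (s * s.+1))) (seed q))) n =
  \sum_(m < N) pair_coef r m *
    (q ^+ (p * (m * m)) * kerAqV_iter j m n -
     q ^+ (2 * m).+1 * (q ^+ (p * (m.+1 * m.+1)) * kerAqV_iter j m.+1 n)).
Proof.
move=> q1 lt_nN.
have seedE s : (s <= n)%N ->
    seed q s = \sum_(m < N) ((1 + q)^-1 * seed_coef q m) * kerAq q m s.
  move=> le_sn; apply: (mulfI q1); rewrite seed_sum // mulr_sumr.
  under [RHS]eq_bigr do rewrite -[(_^-1 * _) * _]mulrA mulVKf //.
  rewrite (big_ord_widen N (fun m => seed_coef q m * kerAq q m s)); last by lia.
  rewrite big_mkcond; apply: eq_bigr => m _; case: ltnP => // lt_sm.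
  by rewrite /kerAq leqNgt lt_sm mulr0.
(* The r inner levels are diagonal on the kernels a = q; then [kerAq_A1] passes to a = 1. *)
have rE s : (s <= n)%N ->
    iter r (level q (fun s => q ^+ (s * s.+1))) (seed q) s =
    \sum_(m < N) pair_coef r m *
      (1 * kerA1 q m s + - q ^+ (2 * m).+1 * kerA1 q m.+1 s).
  move=> le_sn.
  rewrite (eq_iter_level _ _ (fun s => \sum_(m < N) ((1 + q)^-1 * seed_coef q m) * kerAq q m s)); last first.
    by move=> t le_ts; apply: seedE; apply: leq_trans le_sn.
  rewrite iter_level_sum; apply: eq_bigr => m _.
  rewrite (iter_level_eigen _ _ (q ^+ (m * m.+1))); last by move=> ?; exact: level_kerAq.
  rewrite /seed_coef /pair_coef mul1r mulNr -exprM [(r * _)%N]mulnC [q ^+ (m * m.-1 + _)]exprD.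
  have := kerAq_A1 q_neq m s; set y := kerA1 _ _ _ - _ => eA.
  rewrite -!mulrA -eA; set x := kerAq _ _ _; ring.
(* The p middle levels are diagonal on the kernels a = 1. *)
rewrite (eq_iter_level _ _ (fun s => \sum_(m < N) pair_coef r m *
    (q ^+ (p * (m * m)) * kerA1 q m s +
     - (q ^+ (2 * m).+1 * q ^+ (p * (m.+1 * m.+1))) * kerA1 q m.+1 s))); last first.
  move=> s le_sn.
  rewrite (eq_iter_level _ _ (fun s => \sum_(m < N) pair_coef r m *
      (1 * kerA1 q m s + - q ^+ (2 * m).+1 * kerA1 q m.+1 s))); last first.
    by move=> t le_ts; apply: rE; apply: leq_trans le_sn.
  rewrite (iter_level_sum _ _ _ _ (fun (m : 'I_N) s => 1 * kerA1 q m s + - q ^+ (2 * m).+1 * kerA1 q m.+1 s)).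
  apply: eq_bigr => m _; rewrite iter_level_lin.
  have eig m' : iter p (level q (fun s => q ^+ (s * s))) (kerA1 q m') s =
      q ^+ (p * (m' * m')) * kerA1 q m' s.
    rewrite (iter_level_eigen _ _ (q ^+ (m' * m'))); last by move=> ?; exact: level_kerA1.
    by rewrite -exprM mulnC.
  by rewrite !eig mul1r !mulNr mulrA.
rewrite (iter_level_sum _ _ _ _ (fun (m : 'I_N) s => q ^+ (p * (m * m)) * kerA1 q m s +
     - (q ^+ (2 * m).+1 * q ^+ (p * (m.+1 * m.+1))) * kerA1 q m.+1 s)).
apply: eq_bigr => m _; rewrite iter_level_lin !iter_level_kerA1_AqV.
by rewrite mulNr mulrA.
Qed.

End Iterate.

(** * The triple product *)

Section FiniteTripleProduct.
Variables (F : fieldType) (x y : F).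
Hypothesis q_neq : forall n : nat, 1 - (x * y) ^+ n.+1 != 0.
Local Notation q := (x * y).

(* With d = j - n in Z, this is (-1)^d x^(d(d+1)/2) y^(d(d-1)/2). *)
Let c (n j : nat) : F :=
  if (n <= j)%N then (-1) ^+ (j - n) * (x ^+ 'C((j - n).+1, 2) * y ^+ 'C(j - n, 2))
  else (-1) ^+ (n - j) * (x ^+ 'C(n - j, 2) * y ^+ 'C((n - j).+1, 2)).

(** In terms of d = j - n, raising d by one multiplies the term by -x q^d. Both sides carry extra
    powers of q so that all exponents are natural. *)
Lemma c_x (n p j : nat) : (j <= p + n)%N ->
  x * q ^+ p * c n j = - (q ^+ (p + n - j) * c n j.+1).
Proof.
rewrite /c => le_j; case: leqP => [le_nj|lt_jn].
  rewrite leqW // subSn //.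
  have {1}-> : (p = (p + n - j) + (j - n))%N by lia.
  rewrite exprD !exprMn.
  have -> : ('C((j - n).+2, 2) = 'C((j - n).+1, 2) + (j - n).+1)%N by rewrite binS bin1 addnC.
  have -> : (y ^+ 'C((j - n).+1, 2) = y ^+ 'C(j - n, 2) * y ^+ (j - n)).
    by rewrite -exprD binS bin1 addnC.
  rewrite !exprD !exprS; ring.
have -> : (p + n - j = p + (n - j))%N by lia.
(* At n = j + 1 the index d + 1 is 0, where both branches of [c] agree. *)
have -> : (if (n <= j.+1)%N then (-1) ^+ (j.+1 - n) * (x ^+ 'C((j.+1 - n).+1, 2) * y ^+ 'C(j.+1 - n, 2))
   else (-1) ^+ (n - j.+1) * (x ^+ 'C(n - j.+1, 2) * y ^+ 'C((n - j.+1).+1, 2)))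
  = (-1) ^+ (n - j.+1) * (x ^+ 'C(n - j.+1, 2) * y ^+ 'C((n - j.+1).+1, 2)).
  case: leqP => // le_nj; have -> : (n = j.+1)%N by lia.
  by rewrite subnn.
have -> : (n - j = (n - j.+1).+1)%N by lia.
move: (n - j.+1)%N => e.
have -> : ('C(e.+2, 2) = 'C(e.+1, 2) + e.+1)%N by rewrite binS bin1 addnC.
have -> : (x ^+ 'C(e.+1, 2) = x ^+ 'C(e, 2) * x ^+ e).
  by rewrite -exprD binS bin1 addnC.
rewrite !exprMn !exprD !exprS; ring.
Qed.

(** Raising n lowers d by one, which multiplies the term by y q^(-d). *)
Lemma c_y (n j : nat) : y * q ^+ n * c n j = - (q ^+ j * c n.+1 j).
Proof.
rewrite /c; case: (leqP n.+1 j) => [lt_nj|/ltnSE le_jn].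
  rewrite ltnW // -(subnKC lt_nj); move: (j - n.+1)%N => e.
  rewrite addKn addSnnS addKn.
  have -> : ('C(e.+2, 2) = 'C(e.+1, 2) + e.+1)%N by rewrite binS bin1 addnC.
  have -> : (y ^+ 'C(e.+1, 2) = y ^+ 'C(e, 2) * y ^+ e).
    by rewrite -exprD binS bin1 addnC.
  rewrite !exprMn !exprD !exprS; ring.
have -> : (if (n <= j)%N then (-1) ^+ (j - n) * (x ^+ 'C((j - n).+1, 2) * y ^+ 'C(j - n, 2))
   else (-1) ^+ (n - j) * (x ^+ 'C(n - j, 2) * y ^+ 'C((n - j).+1, 2)))
  = (-1) ^+ (n - j) * (x ^+ 'C(n - j, 2) * y ^+ 'C((n - j).+1, 2)).
  case: leqP => // le_nj; have -> : (n = j)%N by lia.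
  by rewrite subnn.
rewrite subSn //.
rewrite -(subnKC le_jn); move: (n - j)%N => e; rewrite addKn.
have -> : ('C(e.+2, 2) = 'C(e.+1, 2) + e.+1)%N by rewrite binS bin1 addnC.
have -> : (x ^+ 'C(e.+1, 2) = x ^+ 'C(e, 2) * x ^+ e).
  by rewrite -exprD binS bin1 addnC.
rewrite !exprMn !exprD !exprS; ring.
Qed.

Let qN (N : nat) (s t : nat) : (s + t = N)%N -> 
  1 - q ^+ N = (1 - q ^+ s) + q ^+ s * (1 - q ^+ t).
Proof. by move=> <-; rewrite exprD; ring. Qed.

(** Induction adding one factor at a time, first in y with p = 0 and then in x. The new factor
    splits the left side in two; on the right, 1 - q^N is split over the two Pochhammer indices of
    each term, and [c_y] or [c_x] matches the halves. *)
Lemma finite_triple_product (p n : nat) :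
  \prod_(i < p) (1 - x * q ^+ i) * \prod_(i < n) (1 - y * q ^+ i) * iqpoch q (p + n) =
  \sum_(j < (p + n).+1) c n j * (iqpoch q j * iqpoch q (p + n - j)).
Proof.
elim: p n => [|p IHp] n.
  elim: n => [|n IH].
    by rewrite !big_ord0 big_ord1 /c /= iqpoch0 bin0n !expr0 !mulr1.
  rewrite !add0n in IH *; apply: (mulfI (q_neq n)).
  rewrite [\prod_(i < n.+1) _]big_ord_recr /=.
  rewrite [LHS](_ : _ = \prod_(i < 0) (1 - x * q ^+ i) * \prod_(i < n) (1 - y * q ^+ i) *
      iqpoch q n * (1 - y * q ^+ n)); last by rewrite -(iqpochS q_neq n); ring.
  rewrite IH.
  rewrite [LHS](_ : _ = \sum_(j < n.+1) c n.+1 j.+1 * (iqpoch q j * iqpoch q (n - j)) +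
     \sum_(j < n.+1) q ^+ j * c n.+1 j * (iqpoch q j * iqpoch q (n - j))); last first.
    rewrite mulr_suml -big_split /=; apply: eq_bigr => j _.
    have -> : c n.+1 j.+1 = c n j by rewrite /c ltnS !subSS.
    have := c_y n j; set z := c n j; set z' := c n.+1 j => e.
    rewrite mulrBr mulr1 -[q ^+ j * z']opprK -e; ring.
  rewrite mulr_sumr.
  rewrite [RHS](eq_bigr (fun j : 'I_n.+2 =>
      c n.+1 j * (((1 - q ^+ j) * iqpoch q j) * iqpoch q (n.+1 - j)) +
      q ^+ j * c n.+1 j * (iqpoch q j * ((1 - q ^+ (n.+1 - j)) * iqpoch q (n.+1 - j))))); last first.
    move=> j _; rewrite (qN n.+1 j (n.+1 - j)); first by ring.
    by rewrite subnKC // -ltnS.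
  rewrite big_split /=; congr (_ + _).
    rewrite [RHS]big_ord_recl /= expr0 subrr !mul0r mulr0 add0r.
    by apply: eq_bigr => j _; rewrite /bump /= add1n iqpochS // subSS.
  rewrite [RHS]big_ord_recr /= subnn expr0 subrr mul0r !mulr0 addr0.
  by apply: eq_bigr => j _; rewrite subSn ?iqpochS // -ltnS.
apply: (mulfI (q_neq (p + n))); rewrite [\prod_(i < p.+1) _]big_ord_recr /= addSn.
rewrite [LHS](_ : _ = \prod_(i < p) (1 - x * q ^+ i) * \prod_(i < n) (1 - y * q ^+ i) *
    iqpoch q (p + n) * (1 - x * q ^+ p)); last by rewrite -(iqpochS q_neq (p + n)); ring.
rewrite IHp.
rewrite [LHS](_ : _ = \sum_(j < (p + n).+1) c n j * (iqpoch q j * iqpoch q (p + n - j)) +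
   \sum_(j < (p + n).+1) q ^+ (p + n - j) * c n j.+1 * (iqpoch q j * iqpoch q (p + n - j))); last first.
  rewrite mulr_suml -big_split /=; apply: eq_bigr => j _.
  have := c_x n p j (ltn_ord j); set z := c n j; set z' := c n j.+1 => e.
  rewrite -[q ^+ _ * z']opprK -e; ring.
rewrite mulr_sumr.
rewrite [RHS](eq_bigr (fun j : 'I_(p + n).+2 =>
    c n j * (iqpoch q j * ((1 - q ^+ ((p + n).+1 - j)) * iqpoch q ((p + n).+1 - j))) +
    q ^+ ((p + n).+1 - j) * c n j * (((1 - q ^+ j) * iqpoch q j) * iqpoch q ((p + n).+1 - j)))); last first.
  move=> j _; rewrite (qN (p + n).+1 ((p + n).+1 - j) j); first by ring.
  by rewrite subnK // -ltnS.
rewrite big_split /=; congr (_ + _).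
  rewrite [RHS]big_ord_recr /= subnn expr0 subrr mul0r !mulr0 addr0.
  by apply: eq_bigr => j _; rewrite subSn ?iqpochS // -ltnS.
rewrite [RHS]big_ord_recl /= expr0 subrr !mul0r mulr0 add0r.
by apply: eq_bigr => j _; rewrite /bump /= add1n iqpochS // subSS.
Qed.

(* The terms of index m and -1-m of the bilateral series of the triple product. *)
Definition theta_coef (m : nat) : F :=
  (-1) ^+ m * (x ^+ 'C(m.+1, 2) * y ^+ 'C(m, 2) - x ^+ 'C(m.+1, 2) * y ^+ 'C(m.+2, 2)).

(** With n factors in x and n + 1 in y, the terms d = m and d = -1 - m share the denominator
    (q)_(n-m) (q)_(n+m+1), so folding the sum produces the kernels a = q. *)
Lemma finite_triple_product_kerAq (n : nat) :
  \prod_(i < n) (1 - x * q ^+ i) * \prod_(i < n.+1) (1 - y * q ^+ i) *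
    iqpoch q (n + n).+1 =
  \sum_(m < n.+1) theta_coef m * kerAq q m n.
Proof.
have := finite_triple_product n n.+1; rewrite addnS => ->.
rewrite (_ : (n + n).+2 = n.+1 + n.+1)%N; last by lia.
rewrite big_split_ord /= addrC [X in _ + X](reindex_inj rev_ord_inj) /= -big_split /=.
apply: eq_bigr => m _; have le_mn : (m <= n)%N by rewrite -ltnS.
rewrite /theta_coef /kerAq le_mn /c leq_addr addKn.
rewrite (_ : (n < n.+1 - m.+1)%N = false); last by lia.
rewrite (_ : (n.+1 - (n.+1 - m.+1) = m.+1)%N); last by lia.
rewrite (_ : ((n + n).+1 - (n.+1 - m.+1) = (n + m).+1)%N); last by lia.
rewrite (_ : ((n + n).+1 - (n.+1 + m) = n - m)%N); last by lia.
rewrite addSn subSS exprS; ring.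
Qed.

End FiniteTripleProduct.
Arguments theta_coef {F} x y m.
Arguments finite_triple_product_kerAq {F x y}.

(** * Convergence over the complex numbers *)

Import Normc.

Section ComplexModulus.
Variable R : realType.
Implicit Types (z : R[i]) (u : nat -> R[i]).

Lemma normc_ge0 z : 0 <= normc z.
Proof. by rewrite -ler0c; exact: (normr_ge0 z). Qed.

Lemma normcX z n : normc (z ^+ n) = normc z ^+ n.
Proof. by elim: n => [|n IH]; rewrite ?expr0 ?normc1 // !exprS normcM IH. Qed.

Lemma normcB z z' : normc (z - z') = normc (z' - z).
Proof. by rewrite -normcN opprB. Qed.

Lemma normcN1X n : normc ((-1) ^+ n : R[i]) = 1.
Proof. by rewrite normcX normcN normc1 expr1n. Qed.

Lemma normc_sum (I : Type) (r : seq I) (P : pred I) (G : I -> R[i]) :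
  normc (\sum_(i <- r | P i) G i) <= \sum_(i <- r | P i) normc (G i).
Proof.
elim/big_ind2: _ => [|x a y b hx hy|//]; first by rewrite normc0.
by apply: le_trans (le_normcD _ _) _; exact: lerD.
Qed.

Lemma normc_prod (I : Type) (r : seq I) (P : pred I) (G : I -> R[i]) :
  normc (\prod_(i <- r | P i) G i) = \prod_(i <- r | P i) normc (G i).
Proof. by apply: (big_morph _ (@normcM R)); exact: normc1. Qed.

Lemma normc_le_ReIm z : normc z <= `|complex.Re z| + `|complex.Im z|.
Proof.
case: z => a b /=; rewrite -(@ler_pXn2r _ 2) ?nnegrE ?sqrtr_ge0 ?addr_ge0 //.
rewrite sqr_sqrtr ?addr_ge0 ?sqr_ge0 // sqrrD !real_normK ?num_real //.
by rewrite -addrA lerD2l lerDr mulrn_wge0 // mulr_ge0.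
Qed.

(** Carries limits in [R[i]], whose norm is complex-valued, over to real limits. *)
Lemma cvg_normcP (T : Type) (G : set_system T) {FG : Filter G} (u : T -> R[i]) (l : R[i]) :
  u x @[x --> G] --> l <-> normc (u x - l) @[x --> G] --> (0 : R).
Proof.
rewrite (@cvgrPdist_lt R[i] (R[i] : numFieldType)^o) cvgrPdist_lt.
split=> [h e e0|h e].
  have e0' : 0 < e%:C%C by rewrite ltcR.
  near=> x; have : `|l - u x| < e%:C%C by near: x; exact: h.
  move=> lt_e; rewrite sub0r normrN ger0_norm ?normc_ge0 // normcB.
  by rewrite -ltcR; exact: lt_e.
(* In the order of [R[i]], 0 < e forces e to be real. *)
rewrite ltcE => /andP[/= /eqP ime ree].
near=> x; have : `|0 - normc (u x - l)| < complex.Re e by near: x; exact: h.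
rewrite sub0r normrN ger0_norm ?normc_ge0 // normcB => lt_e.
by rewrite ltcE /= ime eqxx.
Unshelve. all: by end_near.
Qed.

Lemma cvg0_normc_le (T : Type) (G : set_system T) {FG : Filter G} (u : T -> R[i]) (v : T -> R) :
  (forall x, normc (u x) <= v x) -> v x @[x --> G] --> (0 : R) ->
  u x @[x --> G] --> (0 : R[i]).
Proof.
move=> le_uv v0; apply/cvg_normcP.
apply: (squeeze_cvgr _ (cvg_cst 0) v0).
by near=> x; rewrite subr0 normc_ge0 le_uv.
Unshelve. all: by end_near.
Qed.

Lemma cvgM_complex (T : Type) (G : set_system T) {FG : Filter G} (u v : T -> R[i]) (c l : R[i]) :
  u x @[x --> G] --> c -> v x @[x --> G] --> l -> (u x * v x) @[x --> G] --> c * l.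
Proof. exact: cvgM. Qed.

Lemma cvgMr_complex (T : Type) (G : set_system T) {FG : Filter G} (c : R[i]) (u : T -> R[i]) (l : R[i]) :
  u x @[x --> G] --> l -> (c * u x) @[x --> G] --> c * l.
Proof.
have cc : (fun _ : T => c) x @[x --> G] --> c by exact: cvg_cst.
exact: (cvgM_complex _ _ _ _ _ _ cc).
Qed.

Lemma hausdorffC : hausdorff_space R[i].
Proof. exact: (@norm_hausdorff _ (R[i] : numFieldType)^o). Qed.

Lemma partial_sums_tail (M : nat -> R) (B e : R) :
    (forall m, 0 <= M m) -> (forall N, \sum_(m < N) M m <= B) -> 0 < e ->
  exists N, forall N', \sum_(N <= m < N') M m < e.
Proof.
move=> M0 MB e0.
have nd : nondecreasing_seq (fun N => \sum_(m < N) M m).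
  move=> a b le_ab; rewrite -!(big_mkord predT M) [leRHS](big_cat_nat _ le_ab) //=.
  by rewrite lerDl sumr_ge0.
have cv : cvgn (fun N => \sum_(m < N) M m).
  by apply: nondecreasing_is_cvgn => //; exists B => _ [N _ <-].
have lim_ub := nondecreasing_cvgn_le nd cv.
move/cvgrPdist_lt : (cv) => /(_ e e0) [N _ hN]; exists N => N'.
have [le_NN'|lt_N'N] := leqP N N'; last by rewrite big_geq // ltnW.
have := hN N (leqnn N); have := lim_ub N'; have := lim_ub N.
rewrite -!(big_mkord predT M) (big_cat_nat _ le_NN') //=.
move=> h1 h2; rewrite ger0_norm ?subr_ge0 // => h3; lra.
Qed.

(** Dominated convergence for series: beyond some [N] the majorant contributes less than e / 2, and
    the first [N] terms form a finite sum tending to 0. As the limit is 0, [f] may be arbitrary. *)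
Lemma tannery (b : nat -> nat -> R[i]) (M : nat -> R) (B : R) (f : nat -> nat) :
    (forall n m, normc (b n m) <= M m) -> (forall N, \sum_(m < N) M m <= B) ->
    (forall m, b n m @[n --> \oo] --> (0 : R[i])) ->
  \sum_(m < f n) b n m @[n --> \oo] --> (0 : R[i]).
Proof.
move=> bM MB b0.
have M0 m : 0 <= M m := le_trans (normc_ge0 _) (bM 0%N m).
pose a n m := normc (b n m).
apply: (@cvg0_normc_le _ _ _ _ (fun n => \sum_(m < f n) a n m)).
  by move=> n; exact: normc_sum.
apply/cvgrPdist_lt => e e0.
have e20 : 0 < e / 2 by lra.
have [N hN] := partial_sums_tail _ _ _ M0 MB e20.
have aN : \sum_(m < N) a n m @[n --> \oo] --> (0 : R).
  elim: (N) => [|N' IH].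
    under eq_fun do rewrite big_ord0.
    exact: cvg_cst.
  under eq_fun do rewrite big_ord_recr /=.
  have h : a n N' @[n --> \oo] --> (0 : R).
    by move/cvg_normcP: (b0 N'); under eq_fun do rewrite subr0.
  by have := cvgD IH h; rewrite addr0; exact.
have a0 n : 0 <= \sum_(m < f n) a n m by apply: sumr_ge0 => *; exact: normc_ge0.
near=> n; rewrite sub0r normrN ger0_norm //.
have : `|0 - \sum_(m < N) a n m| < e / 2.
  by near: n; move/cvgrPdist_lt : aN; apply.
rewrite sub0r normrN ger0_norm; last by apply: sumr_ge0 => *; exact: normc_ge0.
move=> hN1; have h := hN (maxn N (f n)).
apply: (@le_lt_trans _ _ (\sum_(m < N) a n m + \sum_(N <= m < maxn N (f n)) M m)); last by lra.
apply: (@le_trans _ _ (\sum_(m < maxn N (f n)) a n m)).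
  rewrite -!(big_mkord predT (a n)) [leRHS](big_cat_nat _ (leq_maxr N (f n))) //=.
  by rewrite lerDl sumr_ge0 // => *; exact: normc_ge0.
rewrite -!(big_mkord predT (a n)) [leLHS](big_cat_nat _ (leq_maxl N (f n))) //=.
by rewrite lerD2l; apply: ler_sum => m _; exact: bM.
Unshelve. all: by end_near.
Qed.

(** Real and imaginary parts also have bounded variation, so each is a constant plus an absolutely
    convergent real series. *)
Lemma cvgn_bounded_variation u (B : R) :
  (forall N, \sum_(n < N) normc (u n.+1 - u n) <= B) -> cvgn u.
Proof.
move=> uB.
have real_cvg (v : nat -> R) :
    (forall n, `|v n.+1 - v n| <= normc (u n.+1 - u n)) -> cvgn v.
  move=> hv; have : cvgn (series (fun n => v n.+1 - v n)).
    apply: normed_cvg; apply: nondecreasing_is_cvgn.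
      apply: nondecreasing_series => n _ _; exact: normr_ge0.
    exists B => _ [N _ <-]; apply: le_trans (uB N).
    by rewrite /normed_series_of /= /series /= big_mkord; apply: ler_sum => n _; exact: hv.
  have -> : series (fun n => v n.+1 - v n) = (fun n => v n - v 0%N).
    by apply/funext => n; rewrite /series /= telescope_sumr.
  move=> cv; have -> : v = (fun n => (v n - v 0%N) + v 0%N).
    by apply/funext => n; rewrite subrK.
  by apply: is_cvgD => //; exact: is_cvg_cst.
have reN z : `|complex.Re z| <= normc z.
  by rewrite -lecR; exact: normc_ge_Re.
have imN z : `|complex.Im z| <= normc z.
  case: z => x y /=; rewrite -sqrtr_sqr ler_wsqrtr // lerDr sqr_ge0 //.
have cre : cvgn (fun n => complex.Re (u n)).
  apply: real_cvg => n; apply: le_trans (reN _).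
  by case: (u n.+1) (u n) => [? ?] [? ?].
have cim : cvgn (fun n => complex.Im (u n)).
  apply: real_cvg => n; apply: le_trans (imN _).
  by case: (u n.+1) (u n) => [? ?] [? ?].
apply/cvg_ex; exists (Complex (lim (complex.Re (u n) @[n --> \oo]))
  (lim (complex.Im (u n) @[n --> \oo]))).
set l := Complex _ _.
have : (u n - l) @[n --> \oo] --> (0 : R[i]).
  apply: (@cvg0_normc_le _ _ _ _ (fun n => `|complex.Re (u n) - complex.Re l| +
     `|complex.Im (u n) - complex.Im l|)).
    by move=> n; apply: le_trans (normc_le_ReIm _) _; case: (u n).
  rewrite -[0 : R]addr0; apply: cvgD.
    have : (complex.Re (u n) - complex.Re l) @[n --> \oo] --> (0 : R).
      by rewrite -(subrr (complex.Re l)); apply: cvgB => //; exact: cvg_cst.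
    by move/cvg_norm; rewrite normr0.
  have : (complex.Im (u n) - complex.Im l) @[n --> \oo] --> (0 : R).
    by rewrite -(subrr (complex.Im l)); apply: cvgB => //; exact: cvg_cst.
  by move/cvg_norm; rewrite normr0.
by move/cvg_normcP => h; apply/cvg_normcP; under eq_fun do rewrite -[_ - l]subr0.
Qed.

Lemma geometric_sum_le (rho : R) (N : nat) :
  0 <= rho -> rho < 1 -> \sum_(m < N) rho ^+ m <= (1 - rho)^-1.
Proof.
move=> r0 r1; have r1' : 0 < 1 - rho by lra.
rewrite -(ler_pM2l r1') mulfV ?gt_eqF //.
have -> : (1 - rho) * \sum_(m < N) rho ^+ m = 1 - rho ^+ N.
  by rewrite -[RHS]opprB subrX1 -mulNr opprB.
by rewrite lerBlDr lerDl exprn_ge0.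
Qed.

(** The exponent [m.-1] is a lower bound for both m^2 - m and the binomial (m choose 2), which occur
    in the weights. *)
Lemma geometric_pred_sum_le (rho : R) (N : nat) :
  0 <= rho -> rho < 1 -> \sum_(m < N) rho ^+ m.-1 <= 1 + (1 - rho)^-1.
Proof.
move=> r0 r1; case: N => [|N].
  by rewrite big_ord0 addr_ge0 // invr_ge0; lra.
by rewrite big_ord_recl /= expr0 lerD2l; exact: geometric_sum_le.
Qed.

Lemma prod_1D_geometric_le (c rho : R) (N : nat) :
  0 <= c -> 0 <= rho -> rho < 1 ->
  \prod_(m < N) (1 + c * rho ^+ m) <= expR (c / (1 - rho)).
Proof.
move=> c0 r0 r1; apply: (@le_trans _ _ (expR (\sum_(m < N) c * rho ^+ m))).
  rewrite expR_sum; apply: ler_prod => m _.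
  by rewrite expR_ge1Dx addr_ge0 // mulr_ge0 ?exprn_ge0.
by rewrite ler_expR -mulr_sumr ler_wpM2l // geometric_sum_le.
Qed.

End ComplexModulus.

(** * Infinite q-products and their reciprocals *)

Section QProducts.
Variables (R : realType) (q : R[i]).
Hypothesis q1 : normc q < 1.
Local Notation rho := (normc q).

Let rho0 : 0 <= rho. Proof. exact: normc_ge0. Qed.

Lemma qpoch_partial_le (a : R[i]) (N : nat) :
  normc (\prod_(m < N) (1 - a * q ^+ m)) <= expR (normc a / (1 - rho)).
Proof.
rewrite normc_prod; apply: le_trans (prod_1D_geometric_le _ (normc a) rho N _ _ _) => //; last exact: normc_ge0.
apply: ler_prod => m _; rewrite normc_ge0 /=.
apply: le_trans (le_normcD _ _) _.
by rewrite normc1 normcN normcM normcX.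
Qed.

(** Consecutive partial products differ by a q^n times a bounded product, hence have bounded
    variation. *)
Lemma qpoch_inf_cvg (a : R[i]) :
  \prod_(m < n) (1 - a * q ^+ m) @[n --> \oo] --> qpoch_inf a q.
Proof.
pose B := expR (normc a / (1 - rho)).
apply: (@cvgn_bounded_variation _ _ (B * normc a * (1 - rho)^-1)) => N.
apply: (@le_trans _ _ (\sum_(n < N) B * normc a * rho ^+ n)).
  apply: ler_sum => n _; rewrite big_ord_recr /= mulrBr mulr1 addrAC subrr add0r.
  rewrite normcN !normcM normcX -mulrA ler_wpM2r ?qpoch_partial_le //.
  by rewrite mulr_ge0 ?exprn_ge0 ?normc_ge0.
rewrite -mulr_sumr ler_wpM2l ?geometric_sum_le // mulr_ge0 ?normc_ge0 //.
exact: expR_ge0.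
Qed.

Lemma one_minus_expr_neq0 (n : nat) : 1 - q ^+ n.+1 != 0.
Proof.
apply: contraTneq q1 => /eqP; rewrite subr_eq0 => /eqP e.
have : rho ^+ n.+1 = 1 by rewrite -normcX -e normc1.
by move=> /eqP; rewrite pexprn_eq1 ?normc_ge0 //= => /eqP ->; rewrite ltxx.
Qed.

(** Comes from 1 / |1 - q^(i+1)| <= 1 + |q|^i / (1 - |q|) and 1 + t <= exp t. *)
Definition iqpoch_bound : R := expR ((1 - rho)^-1 / (1 - rho)).

Lemma iqpoch_le (n : nat) : normc (iqpoch q n) <= iqpoch_bound.
Proof.
have r1 : 0 < 1 - rho by rewrite subr_gt0.
rewrite /iqpoch normc_prod.
apply: le_trans (prod_1D_geometric_le _ (1 - rho)^-1 rho n _ _ _) => //; last by rewrite invr_ge0 ltW.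
apply: ler_prod => i _; rewrite normc_ge0 /= normcV.
set d := normc _; set t := rho ^+ i.
have dt : 1 - rho * t <= d.
  have := le_normcD (1 - q ^+ i.+1) (q ^+ i.+1).
  by rewrite subrK normc1 -/d normcX exprS -/t; lra.
have t0 : 0 <= t by rewrite exprn_ge0.
have t1 : t <= 1 by rewrite exprn_ile1 // ltW.
have rt : rho * t <= rho by rewrite ler_piMr.
have rt' : rho * t <= t by rewrite ler_piMl // ltW.
have d0 : 0 < d by have := q1; lra.
rewrite -(ler_pM2l d0) mulfV ?gt_eqF // mulrDr mulr1.
have : t <= d * ((1 - rho)^-1 * t).
  rewrite mulrA -[leLHS]mul1r ler_wpM2r // -(ler_pM2r r1) mul1r mulfVK ?gt_eqF //.
  lra.
lra.
Qed.

Lemma prod_iqpoch (n : nat) : \prod_(m < n) (1 - q * q ^+ m) * iqpoch q n = 1.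
Proof.
rewrite /iqpoch -big_split big1 //= => i _.
by rewrite -exprS mulfV // one_minus_expr_neq0.
Qed.

(** The reciprocals of the partial products are bounded, so the products stay away from 0. *)
Lemma qpoch_inf_neq0 : qpoch_inf q q != 0.
Proof.
apply/negP => /eqP e0.
have := qpoch_inf_cvg q; rewrite e0 => /cvg_normcP /cvgrPdist_lt.
have c0 : 0 < iqpoch_bound^-1 by rewrite invr_gt0 expR_gt0.
move=> /(_ _ c0) [N _ /(_ N (leqnn N))] /=.
rewrite subr0 sub0r normrN ger0_norm ?normc_ge0 //.
apply/negP; rewrite -leNgt -(@ler_pM2r _ (iqpoch_bound)) ?expR_gt0 //.
have e1 : normc (\prod_(m < N) (1 - q * q ^+ m)) * normc (iqpoch q N) = 1.
  by rewrite -normcM prod_iqpoch normc1.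
rewrite mulVf ?gt_eqF ?expR_gt0 // -[leLHS]e1.
by rewrite ler_wpM2l ?normc_ge0 // iqpoch_le.
Qed.

Lemma iqpoch_cvg : iqpoch q n @[n --> \oo] --> (qpoch_inf q q)^-1.
Proof.
have -> : iqpoch q = (fun n => (\prod_(m < n) (1 - q * q ^+ m))^-1).
  apply/funext => n; have P0 : \prod_(m < n) (1 - q * q ^+ m) != 0.
    by apply/eqP => P0; have /eqP := prod_iqpoch n; rewrite P0 mul0r eq_sym oner_eq0.
  by apply: (mulfI P0); rewrite prod_iqpoch mulfV.
by apply: (@cvgV R[i]); [exact: qpoch_inf_neq0|exact: qpoch_inf_cvg].
Qed.

Lemma qpochE (n : nat) : qpoch q q n = (iqpoch q n)^-1.
Proof.
have e : qpoch_inf q q = (iqpoch q n)^-1 * qpoch_inf (q * q ^+ n) q.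
  have h := qpoch_inf_cvg (q * q ^+ n).
  have h2 : \prod_(m < n + m) (1 - q * q ^+ m) @[m --> \oo] --> qpoch_inf q q.
    have := qpoch_inf_cvg q; rewrite -(cvg_shiftn n).
    by under eq_fun do rewrite addnC.
  have h3 : \prod_(m < n + m) (1 - q * q ^+ m) @[m --> \oo] -->
      (iqpoch q n)^-1 * qpoch_inf (q * q ^+ n) q.
    have -> : (fun m => \prod_(m < n + m) (1 - q * q ^+ m)) =
        (fun m => (iqpoch q n)^-1 * \prod_(i < m) (1 - q * q ^+ n * q ^+ i)).
      apply/funext => m; rewrite big_split_ord /=; congr (_ * _).
        by rewrite /iqpoch prodfV invrK; under eq_bigr do rewrite -exprS.
      by under eq_bigr do rewrite exprD mulrA.
    exact: (cvgMr_complex _ _ _ _ _ _ h).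
  exact: (cvg_unique (@hausdorffC R) h2 h3).
rewrite /qpoch {1}e mulfK //; apply: contraTneq qpoch_inf_neq0 => e0.
by rewrite e e0 mulr0 eqxx.
Qed.

End QProducts.

Lemma cvg_ext_complex (R : realType) (u v : nat -> R[i]) (l : R[i]) :
  u =1 v -> u n @[n --> \oo] --> l -> v n @[n --> \oo] --> l.
Proof. by move=> /funext ->. Qed.
Arguments cvg_ext_complex {R}.

(** * Limits of the kernels and of the iterated levels *)

Section KernelLimits.
Variables (R : realType) (q : R[i]).
Hypothesis q1 : normc q < 1.
Local Notation rho := (normc q).
Local Notation I := ((qpoch_inf q q)^-1).
Local Notation K := (iqpoch_bound R q).

Lemma cvgB_complex (u v : nat -> R[i]) (a b : R[i]) :
  u n @[n --> \oo] --> a -> v n @[n --> \oo] --> b ->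
  (u n - v n) @[n --> \oo] --> a - b.
Proof. exact: (@cvgB _ (R[i] : numFieldType)^o). Qed.

Lemma cvgD_complex (u v : nat -> R[i]) (a b : R[i]) :
  u n @[n --> \oo] --> a -> v n @[n --> \oo] --> b ->
  (u n + v n) @[n --> \oo] --> a + b.
Proof. exact: (@cvgD _ (R[i] : numFieldType)^o). Qed.

Lemma cvg_cst_complex (a : R[i]) : (fun _ : nat => a) n @[n --> \oo] --> a.
Proof. exact: cvg_cst. Qed.

Lemma cvg_sum_complex (N : nat) (u : nat -> nat -> R[i]) (a : nat -> R[i]) :
  (forall i, (i < N)%N -> u i n @[n --> \oo] --> a i) ->
  \sum_(i < N) u i n @[n --> \oo] --> \sum_(i < N) a i.
Proof.
elim: N => [|N IH] ua.
  rewrite big_ord0; under eq_fun do rewrite big_ord0.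
  exact: cvg_cst_complex.
rewrite big_ord_recr; under eq_fun do rewrite big_ord_recr.
apply: cvgD_complex; last exact: ua.
by apply: IH => i lt_iN; apply: ua; exact: ltnW.
Qed.

Lemma cvg_subr0_complex (u v : nat -> R[i]) (a : R[i]) :
  u n @[n --> \oo] --> a -> (u n - v n) @[n --> \oo] --> (0 : R[i]) ->
  v n @[n --> \oo] --> a.
Proof.
move=> ua uv; have := cvgB_complex _ _ _ _ ua uv; rewrite subr0.
by under eq_fun do rewrite opprB addrC subrK.
Qed.

Lemma K_ge1 : 1 <= K.
Proof.
rewrite /iqpoch_bound -[leLHS]expR0 ler_expR divr_ge0 ?invr_ge0 //.
all: by rewrite subr_ge0; exact: ltW q1.
Qed.

Let K0 : 0 <= K. Proof. exact: le_trans ler01 K_ge1. Qed.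

Lemma iqpoch_shift_cvg (c : nat) : iqpoch q (n + c) @[n --> \oo] --> I.
Proof. by rewrite cvg_shiftn; exact: iqpoch_cvg. Qed.

Lemma kerAq_cvg (m : nat) : kerAq q m n @[n --> \oo] --> I * I.
Proof.
rewrite -(cvg_shiftn m).
have -> : (fun n => kerAq q m (n + m)) = (fun n => iqpoch q n * iqpoch q (n + (m + m).+1)).
  by apply/funext => n; rewrite /kerAq leq_addl addnK addnS addnA.
exact: cvgM_complex (iqpoch_cvg _ _ q1) (iqpoch_shift_cvg _).
Qed.

Lemma kerA1_cvg (m : nat) : kerA1 q m n @[n --> \oo] --> I * I.
Proof.
rewrite -(cvg_shiftn m).
have -> : (fun n => kerA1 q m (n + m)) = (fun n => iqpoch q n * iqpoch q (n + (m + m))).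
  by apply/funext => n; rewrite /kerA1 leq_addl addnK addnA.
exact: cvgM_complex (iqpoch_cvg _ _ q1) (iqpoch_shift_cvg _).
Qed.

Lemma expC_cvg (m : nat) : q ^+ (n + m) @[n --> \oo] --> (0 : R[i]).
Proof.
rewrite cvg_shiftn.
apply: (cvg0_normc_le _ _ _ _ (fun n => rho ^+ n)).
  by move=> n; rewrite normcX.
by apply: cvg_expr; rewrite ger0_norm // normc_ge0.
Qed.

Lemma kerAqV_cvg (m : nat) : kerAqV q m n @[n --> \oo] --> I * I.
Proof.
have h := cvgB_complex _ _ _ _ (cvg_cst_complex 1) (expC_cvg m).
have e : (1 - 0) * (I * I) = I * I by rewrite subr0 mul1r.
rewrite -[X in _ --> X]e; exact: cvgM_complex h (kerA1_cvg m).
Qed.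

Lemma normc_expr_le1 (n : nat) : normc (q ^+ n) <= 1.
Proof. by rewrite normcX exprn_ile1 ?normc_ge0 // ltW. Qed.

Lemma kerAq_le (m n : nat) : normc (kerAq q m n) <= K * K.
Proof.
rewrite /kerAq; case: ifP => _; last by rewrite normc0 mulr_ge0.
by rewrite normcM ler_pM ?normc_ge0 ?iqpoch_le.
Qed.

Lemma kerA1_le (m n : nat) : normc (kerA1 q m n) <= K * K.
Proof.
rewrite /kerA1; case: ifP => _; last by rewrite normc0 mulr_ge0.
by rewrite normcM ler_pM ?normc_ge0 ?iqpoch_le.
Qed.

Lemma kerAqV_le (m n : nat) : normc (kerAqV q m n) <= 2 * (K * K).
Proof.
rewrite /kerAqV normcM ler_pM ?normc_ge0 ?kerA1_le //.
apply: le_trans (le_normcD _ _) _; rewrite normc1 normcN.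
by have := normc_expr_le1 (n + m); lra.
Qed.

(** Both kinds of kernel have the same limit, so the [kerA1] term of [kerAqV_iter] becomes the term
    s = 0 of one sum. *)
Definition kerAqV_iter_lim (j m : nat) : R[i] :=
  \sum_(s < j.+1) q ^+ (j * (m * m.+1) - 2 * (s * m)).

Lemma kerAqV_iter_cvg (j m : nat) :
  kerAqV_iter R[i] q j m n @[n --> \oo] --> kerAqV_iter_lim j m * (I * I).
Proof.
rewrite /kerAqV_iter_lim big_ord_recl /= mul0n muln0 subn0 mulrDl mulr_suml.
apply: cvgD_complex; first exact: cvgMr_complex (kerA1_cvg m).
apply: (cvg_sum_complex j
  (fun s n => q ^+ (j * (m * m.+1) - 2 * (s.+1 * m)) * kerAqV q m n)
  (fun s => q ^+ (j * (m * m.+1) - 2 * (s.+1 * m)) * (I * I))) => s _.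
exact: cvgMr_complex (kerAqV_cvg m).
Qed.

Lemma kerAqV_iter_le (j m n : nat) :
  normc (kerAqV_iter R[i] q j m n) <= (1 + j%:R) * (2 * (K * K)).
Proof.
have KK : 0 <= K * K by rewrite mulr_ge0.
rewrite /kerAqV_iter; apply: le_trans (le_normcD _ _) _; rewrite mulrDl lerD //.
  rewrite normcM ler_pM ?normc_ge0 ?normc_expr_le1 //.
  by apply: le_trans (kerA1_le m n) _; lra.
apply: le_trans (normc_sum _ _ _ _ _) _.
rewrite mulr_natl -[j in leRHS]card_ord -sumr_const; apply: ler_sum => s _.
by rewrite normcM -[leRHS]mul1r ler_pM ?normc_ge0 ?normc_expr_le1 ?kerAqV_le.
Qed.

Lemma normc_lim_le (u : nat -> R[i]) (l : R[i]) (B : R) :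
  (forall n, normc (u n) <= B) -> u n @[n --> \oo] --> l -> normc l <= B.
Proof.
move=> uB /cvg_normcP/cvgrPdist_lt ul; rewrite leNgt; apply/negP => ltB.
have e0 : 0 < normc l - B by rewrite subr_gt0.
have [N _ /(_ N (leqnn N))] := ul _ e0.
rewrite /= sub0r normrN ger0_norm ?normc_ge0 //.
have := le_normcD (l - u N) (u N); rewrite subrK normcB.
by have := uB N; lra.
Qed.

Definition limit_coef (j p r m : nat) : R[i] :=
  pair_coef R[i] q r m *
    (q ^+ (p * (m * m)) * kerAqV_iter_lim j m -
     q ^+ (2 * m).+1 * (q ^+ (p * (m.+1 * m.+1)) * kerAqV_iter_lim j m.+1)).

(** Stated as a difference because the partial sums of [limit_coef] are shown to converge
    separately, by the triple product. Domination comes from the factor q^(m^2-m) of [pair_coef]. *)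
Lemma iter_seed_sub_cvg0 (j p r : nat) : 1 + q != 0 ->
  (iter j (level q (fun s => q ^+ (s * s.-1)))
    (iter p (level q (fun s => q ^+ (s * s)))
      (iter r (level q (fun s => q ^+ (s * s.+1))) (seed q))) n -
   (\sum_(m < n.+1) limit_coef j p r m) * (I * I)) @[n --> \oo] --> (0 : R[i]).
Proof.
move=> q1'.
pose d m n := kerAqV_iter R[i] q j m n - kerAqV_iter_lim j m * (I * I).
pose D : R := (1 + j%:R) * (2 * (K * K)) + (1 + j%:R) * (2 * (K * K)).
have dD m n : normc (d m n) <= D.
  apply: le_trans (le_normcD _ _) _; rewrite normcN lerD ?kerAqV_iter_le //.
  exact: normc_lim_le (kerAqV_iter_le j m) (kerAqV_iter_cvg j m).
have D0 : 0 <= D := le_trans (normc_ge0 _ _) (dD 0%N 0%N).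
have d0 m : d m n @[n --> \oo] --> (0 : R[i]).
  rewrite -(subrr (kerAqV_iter_lim j m * (I * I))).
  exact: cvgB_complex (kerAqV_iter_cvg j m) (cvg_cst_complex _).
pose b n m := pair_coef R[i] q r m *
    (q ^+ (p * (m * m)) * d m n - q ^+ (2 * m).+1 * (q ^+ (p * (m.+1 * m.+1)) * d m.+1 n)).
have -> : (fun n => iter j (level q (fun s => q ^+ (s * s.-1)))
    (iter p (level q (fun s => q ^+ (s * s)))
      (iter r (level q (fun s => q ^+ (s * s.+1))) (seed q))) n -
   (\sum_(m < n.+1) limit_coef j p r m) * (I * I)) = (fun n => \sum_(m < n.+1) b n m).
  apply/funext => n; rewrite (iter_seed _ _ (one_minus_expr_neq0 _ _ q1) j p r n.+1 n) //.
  rewrite mulr_suml -sumrB; apply: eq_bigr => m _.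
  rewrite /b /limit_coef /d; ring.
(* One factor 2 bounds 1 + q^(2m+1), the other counts the two differences [d]. *)
pose c := normc ((1 + q)^-1) * (4 * D).
have c0 : 0 <= c by rewrite mulr_ge0 ?normc_ge0 //; lra.
apply: (tannery _ _ (fun m => c * rho ^+ m.-1) (c * (1 + (1 - rho)^-1)) S).
- move=> n m; rewrite /b /pair_coef !normcM normcN1X mul1r -!mulrA.
  rewrite /= /c -?mulrA ler_wpM2l ?normc_ge0 //.
  have h1 : normc (q ^+ (m * m.-1 + r * (m * m.+1))) <= rho ^+ m.-1.
    rewrite normcX; apply: ler_wiXn2l; rewrite ?normc_ge0 ?ltW //.
    by case: (m) => [|m'] //=; nia.
  have h2 : normc (1 + q ^+ (2 * m).+1) <= 2.
    by apply: le_trans (le_normcD _ _) _; rewrite normc1; have := normc_expr_le1 (2 * m).+1; lra.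
  have h3 i m' : normc (q ^+ i * d m' n) <= D.
    by rewrite normcM -[leRHS]mul1r ler_pM ?normc_ge0 ?normc_expr_le1.
  have h4 : normc (q ^+ (p * (m * m)) * d m n -
      q ^+ (2 * m).+1 * (q ^+ (p * (m.+1 * m.+1)) * d m.+1 n)) <= 2 * D.
    apply: le_trans (le_normcD _ _) _; rewrite normcN mulrA -exprD.
    by have := h3 (p * (m * m))%N m; have := h3 ((2 * m).+1 + p * (m.+1 * m.+1))%N m.+1; lra.
  rewrite (_ : 4 * (D * _) = rho ^+ m.-1 * (2 * (2 * D))); last by ring.
  by rewrite ler_pM ?mulr_ge0 ?normc_ge0 // ler_pM ?normc_ge0.
- move=> N; rewrite -mulr_sumr ler_wpM2l // geometric_pred_sum_le ?normc_ge0 //.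
- move=> m; rewrite /b -(mulr0 (pair_coef R[i] q r m)); apply: cvgMr_complex.
  rewrite -(subr0 (0 : R[i])); apply: cvgB_complex.
    by rewrite -(mulr0 (q ^+ (p * (m * m)))); apply: cvgMr_complex.
  rewrite -(mulr0 (q ^+ (2 * m).+1)); apply: cvgMr_complex.
  by rewrite -(mulr0 (q ^+ (p * (m.+1 * m.+1)))); apply: cvgMr_complex.
Qed.

End KernelLimits.

(** * Jacobi's triple product as a one-sided series *)

Section TripleProduct.
Variables (R : realType) (x y : R[i]).
Hypotheses (x1 : normc x <= 1) (y1 : normc y <= 1) (xy1 : normc (x * y) < 1).
Local Notation rho := (normc (x * y)).
Local Notation I := ((qpoch_inf (x * y) (x * y))^-1).
Local Notation K := (iqpoch_bound R (x * y)).

Lemma leq_pred_bin2 (m : nat) : (m.-1 <= 'C(m, 2))%N.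
Proof. by case: m => // m; rewrite binS bin1 leq_addl. Qed.

(** Each monomial is a power of x y times a power of x or y of modulus at most 1. Equality must be
    allowed, as x = q^0 occurs. *)
Lemma theta_coef_le (m : nat) : normc (theta_coef x y m) <= 2 * rho ^+ m.-1.
Proof.
have bound c (z : R[i]) : (m.-1 <= c)%N -> normc z <= 1 ->
    normc ((x * y) ^+ c * z) <= rho ^+ m.-1.
  move=> le_c z1; rewrite normcM normcX -[leRHS]mulr1.
  rewrite ler_pM ?exprn_ge0 ?normc_ge0 //.
  by apply: ler_wiXn2l; rewrite ?normc_ge0 ?ltW.
have b1 := leq_pred_bin2 m.
have b2 : (m.-1 <= 'C(m.+1, 2))%N by rewrite binS bin1; lia.
rewrite /theta_coef normcM normcN1X mul1r.
apply: le_trans (le_normcD _ _) _; rewrite normcN.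
have -> : x ^+ 'C(m.+1, 2) * y ^+ 'C(m, 2) = (x * y) ^+ 'C(m, 2) * x ^+ m.
  by rewrite binS bin1 exprD exprMn; ring.
have -> : x ^+ 'C(m.+1, 2) * y ^+ 'C(m.+2, 2) = (x * y) ^+ 'C(m.+1, 2) * y ^+ m.+1.
  by rewrite [in 'C(m.+2, 2)]binS bin1 exprD exprMn; ring.
rewrite (_ : 2 * _ = rho ^+ m.-1 + rho ^+ m.-1); last by ring.
by apply: lerD; apply: bound; rewrite // normcX exprn_ile1 ?normc_ge0.
Qed.

(** Let n tend to infinity in [finite_triple_product_kerAq]: every kernel tends to 1 / (xy; xy)_oo^2
    while the left side keeps one such reciprocal. Multiplying by (xy; xy)_oo^2 gives the claim. *)
Lemma theta_series_cvg :
  \sum_(m < n.+1) theta_coef x y m @[n --> \oo] --> qpoch_infs [:: x * y; y; x] (x * y).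
Proof.
have I0 := qpoch_inf_neq0 _ _ xy1.
have K0 : 0 <= K by exact: le_trans ler01 (K_ge1 _ _ xy1).
pose b n m := theta_coef x y m * (kerAq (x * y) m n - I * I).
have b0 : \sum_(m < n.+1) b n m @[n --> \oo] --> (0 : R[i]).
  pose c := 2 * (K * K + K * K).
  have c0 : 0 <= c by rewrite mulr_ge0 // addr_ge0 // mulr_ge0.
  apply: (tannery _ _ (fun m => c * rho ^+ m.-1) (c * (1 + (1 - rho)^-1)) S).
  - move=> n m; rewrite /b normcM /c mulrAC.
    rewrite ler_pM ?normc_ge0 ?theta_coef_le //.
    apply: le_trans (le_normcD _ _) _; rewrite normcN lerD ?kerAq_le //.
    apply: normc_lim_le (kerAq_cvg _ _ xy1 m) => n'; exact: kerAq_le.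
  - move=> N; rewrite -mulr_sumr ler_wpM2l // geometric_pred_sum_le ?normc_ge0 //.
  - move=> m; rewrite -(mulr0 (theta_coef x y m)); apply: cvgMr_complex.
    rewrite -(subrr (I * I)); apply: cvgB_complex; first exact: kerAq_cvg.
    exact: cvg_cst_complex.
have lim1 : \sum_(m < n.+1) theta_coef x y m * kerAq (x * y) m n @[n --> \oo] -->
    qpoch_inf x (x * y) * qpoch_inf y (x * y) * I.
  have -> : (fun n => \sum_(m < n.+1) theta_coef x y m * kerAq (x * y) m n) =
     (fun n => \prod_(i < n) (1 - x * (x * y) ^+ i) *
        \prod_(i < n.+1) (1 - y * (x * y) ^+ i) * iqpoch (x * y) (n + n).+1).
    by apply/funext => n; rewrite finite_triple_product_kerAq //; exact: one_minus_expr_neq0.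
  apply: cvgM_complex.
    apply: cvgM_complex; first exact: qpoch_inf_cvg.
    have := qpoch_inf_cvg _ _ xy1 y; rewrite -(cvg_shiftn 1).
    by under eq_fun do rewrite addn1.
  have dbl : (fun n => (n + n).+1) @ \oo --> \oo.
    by move=> P [N _ hN]; exists N => // n /= le_Nn; apply: hN => /=; lia.
  exact: cvg_comp dbl (iqpoch_cvg _ _ xy1).
have lim2 : (\sum_(m < n.+1) theta_coef x y m) * (I * I) @[n --> \oo] -->
    qpoch_inf x (x * y) * qpoch_inf y (x * y) * I.
  apply: cvg_subr0_complex lim1 _.
  have -> : (fun n => \sum_(m < n.+1) theta_coef x y m * kerAq (x * y) m n -
      (\sum_(m < n.+1) theta_coef x y m) * (I * I)) = (fun n => \sum_(m < n.+1) b n m).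
    apply/funext => n; rewrite mulr_suml -sumrB; apply: eq_bigr => m _.
    by rewrite /b mulrBr.
  exact: b0.
pose J := qpoch_inf (x * y) (x * y).
have e : J * J * (qpoch_inf x (x * y) * qpoch_inf y (x * y) * I) =
    qpoch_infs [:: x * y; y; x] (x * y).
  by rewrite /qpoch_infs !big_cons big_nil mulr1 -/J; field.
rewrite -[X in _ --> X]e; apply: (cvg_ext_complex _ _ _ _ (cvgMr_complex _ _ _ (J * J) _ _ lim2)) => n.
by rewrite -/J; field.
Qed.

End TripleProduct.

(** * The limiting coefficients as theta terms *)

Section LimitCoefficient.
Variables (R : realType) (q : R[i]).

Lemma bin2_double (m : nat) : (m * m.-1 = 2 * 'C(m, 2))%N.
Proof.
elim: m => [|m IH] //; rewrite binS bin1 mulnDr -IH /=.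
by case: (m) => //= n; nia.
Qed.

(** Multiplying out (1 + q^(2m+1)) (q^a - q^(2m+1+b)) gives four powers: the extreme two form the
    first theta term, the middle two the second. *)
Lemma limit_coef_theta (j p r k m : nat) : (k = r + j + p)%N ->
  limit_coef R q j p r m = (1 + q)^-1 * \sum_(s < j.+1)
    (theta_coef (q ^+ (k + r + 2 * s - j)) (q ^+ (k + 2 + j - (r + 2 * s))) m +
     q * theta_coef (q ^+ (k + 2 + r + 2 * s - j)) (q ^+ (k + j - (r + 2 * s))) m).
Proof.
move=> ->; rewrite /limit_coef /pair_coef /kerAqV_iter_lim -[LHS]mulrA; congr (_ * _).
(* Only the sum at [m] is reversed, so that its term j - s meets term s of the sum at m + 1. *)
rewrite [X in _ ^+ (p * (m * m)) * X](reindex_inj rev_ord_inj) /=.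
rewrite !mulr_sumr -sumrB mulr_sumr; apply: eq_bigr => -[s /= le_sj] _; rewrite ltnS in le_sj.
(* Writing j = s + t makes every truncated subtraction explicit. *)
have [t jE] : exists t, (j = s + t)%N by exists (j - s)%N; rewrite subnKC.
rewrite subSS /theta_coef.
have b1 : ('C(m.+1, 2) = 'C(m, 2) + m)%N by rewrite binS bin1.
have b2 : ('C(m.+2, 2) = 'C(m, 2) + m + m.+1)%N by rewrite binS bin1 b1.
rewrite b2 b1 -!exprM.
have m1 := bin2_double m.
set c := 'C(m, 2) in m1 *.
have m2 : (m * m.+1 = 2 * c + 2 * m)%N by nia.
have m3 : (m * m = 2 * c + m)%N by nia.
have m4 : (m.+1 * m.+1 = 2 * c + 3 * m + 1)%N by nia.
have m5 : (m.+1 * m.+2 = 2 * c + 4 * m + 2)%N by nia.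
rewrite m1 m2 m3 m4 m5 jE.
rewrite (_ : (r + (s + t) + p + r + 2 * s - (s + t) = r + r + p + 2 * s)%N); last by lia.
rewrite (_ : (r + (s + t) + p + 2 + (s + t) - (r + 2 * s) = p + 2 + 2 * t)%N); last by lia.
rewrite (_ : (r + (s + t) + p + 2 + r + 2 * s - (s + t) = r + r + p + 2 * s + 2)%N); last by lia.
rewrite (_ : (r + (s + t) + p + (s + t) - (r + 2 * s) = p + 2 * t)%N); last by lia.
rewrite addKn.
rewrite (_ : ((s + t) * (2 * c + 2 * m) - 2 * (t * m) = 2 * s * c + 2 * s * m + 2 * t * c)%N); last by nia.
rewrite (_ : ((s + t) * (2 * c + 4 * m + 2) - 2 * (s * m.+1) =
   2 * s * c + 2 * t * c + 2 * s * m + 4 * t * m + 2 * t)%N); last by nia.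
rewrite -!exprD.
set E0 := (2 * c + _)%N; set D := (2 * m).+1.
set A := (p * _ + (2 * s * c + 2 * s * m + 2 * t * c))%N.
set B := (p * _ + (2 * s * c + 2 * t * c + 2 * s * m + 4 * t * m + 2 * t))%N.
have expand (z : R[i]) (e d a b : nat) :
    z * q ^+ e * (1 + q ^+ d) * (q ^+ a - q ^+ (d + b)) =
    z * (q ^+ (e + a) - q ^+ (e + d + d + b) + (q ^+ (e + d + a) - q ^+ (e + d + b))).
  by rewrite !exprD; ring.
rewrite expand {expand}.
rewrite mulrDr; congr (_ + _).
  by congr (_ * (q ^+ _ - q ^+ _)); rewrite /E0 /D /A /B; nia.
rewrite [RHS]mulrCA; congr (_ * _); rewrite mulrBr -!exprS.
by congr (q ^+ _ - q ^+ _); rewrite /E0 /D /A /B; nia.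
Qed.

End LimitCoefficient.

(** * Summing the theta terms over m *)

Section LimitSum.
Variables (R : realType) (q : R[i]).
Hypothesis q1 : normc q < 1.

Lemma theta_power_cvg (k a b : nat) : (a + b = 2 * k + 2)%N ->
  \sum_(m < n.+1) theta_coef (q ^+ a) (q ^+ b) m @[n --> \oo] -->
  qpoch_infs [:: q ^+ (2 * k + 2); q ^+ b; q ^+ a] (q ^+ (2 * k + 2)).
Proof.
move=> e; have <- : q ^+ a * q ^+ b = q ^+ (2 * k + 2) by rewrite -exprD e.
apply: theta_series_cvg; rewrite ?normc_expr_le1 // -exprD e normcX.
by rewrite exprn_ilt1 ?normc_ge0 // addn2.
Qed.

Lemma limit_coef_sum_cvg (j p r k : nat) : (k = r + j + p)%N ->
  \sum_(m < n.+1) limit_coef R q j p r m @[n --> \oo] -->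
  (1 + q)^-1 * \sum_(s < j.+1)
    (qpoch_infs [:: q ^+ (2 * k + 2); q ^+ (k + 2 + j - (r + 2 * s)); q ^+ (k + r + 2 * s - j)]
       (q ^+ (2 * k + 2)) +
     q * qpoch_infs [:: q ^+ (2 * k + 2); q ^+ (k + j - (r + 2 * s)); q ^+ (k + 2 + r + 2 * s - j)]
       (q ^+ (2 * k + 2))).
Proof.
move=> kE.
apply: (cvg_ext_complex (fun n => (1 + q)^-1 * \sum_(s < j.+1)
    (\sum_(m < n.+1) theta_coef (q ^+ (k + r + 2 * s - j)) (q ^+ (k + 2 + j - (r + 2 * s))) m +
     q * \sum_(m < n.+1) theta_coef (q ^+ (k + 2 + r + 2 * s - j)) (q ^+ (k + j - (r + 2 * s))) m))).
  move=> n; under [RHS]eq_bigr do rewrite (limit_coef_theta _ _ _ _ _ _ _ kE).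
  rewrite -mulr_sumr exchange_big; congr (_ * _); apply: eq_bigr => s _.
  by rewrite big_split mulr_sumr.
apply: cvgMr_complex.
apply: (cvg_sum_complex _ _
  (fun s n => \sum_(m < n.+1) theta_coef (q ^+ (k + r + 2 * s - j)) (q ^+ (k + 2 + j - (r + 2 * s))) m +
     q * \sum_(m < n.+1) theta_coef (q ^+ (k + 2 + r + 2 * s - j)) (q ^+ (k + j - (r + 2 * s))) m)
  (fun s => qpoch_infs [:: q ^+ (2 * k + 2); q ^+ (k + 2 + j - (r + 2 * s)); q ^+ (k + r + 2 * s - j)]
       (q ^+ (2 * k + 2)) +
     q * qpoch_infs [:: q ^+ (2 * k + 2); q ^+ (k + j - (r + 2 * s)); q ^+ (k + 2 + r + 2 * s - j)]
       (q ^+ (2 * k + 2)))) => s; rewrite ltnS => le_sj.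
(* As s <= j and j + r <= k, no subtraction truncates and each pair of exponents adds up to 2k +
   2. *)
apply: cvgD_complex; first by apply: theta_power_cvg; lia.
by apply: cvgMr_complex; apply: theta_power_cvg; lia.
Qed.

End LimitSum.

(** * Sums over chains *)

Section Nets.

Lemma big_uniq_subset (V : nmodType) (I : eqType) (s t : seq I) (P : pred I) (G : I -> V) :
  uniq s -> uniq t -> {subset s <= t} ->
  \sum_(i <- t | P i) G i = \sum_(i <- s | P i) G i + \sum_(i <- t | P i && (i \notin s)) G i.
Proof.
move=> us ut st; rewrite (bigID [in s]) /=; congr (_ + _).
rewrite (eq_bigl (fun i => (i \in s) && P i)) => [|i]; last exact: andbC.
rewrite -big_filter_cond; apply: perm_big.
apply: uniq_perm; rewrite ?filter_uniq // => i; rewrite mem_filter.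
by case: (boolP (i \in s)) => //= /st ->.
Qed.

(** Unordered summation from summation along an exhaustion [A] with bounded absolute sums: a finite
    set containing [A N] adds only terms outside [A N], whose moduli sum to less than e / 2. *)
Lemma cvg_totally (R : realType) (I : choiceType) (a : I -> R[i]) (A : nat -> seq I)
    (B : R) (l : R[i]) :
    (forall n, uniq (A n)) ->
    (forall m n, (m <= n)%N -> {subset A m <= A n}) ->
    (forall i, exists n, i \in A n) ->
    (forall n, \sum_(i <- A n) normc (a i) <= B) ->
    \sum_(i <- A n) a i @[n --> \oo] --> l ->
  partial_sum a @ totally --> l.
Proof.
move=> uA incr cover bound lim.
have tail e : 0 < e -> exists N, forall N', (N <= N')%N ->
    \sum_(i <- A N' | i \notin A N) normc (a i) < e.
  move=> e0.
  pose T n := \sum_(i <- A n) normc (a i).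
  have TD m n : (m <= n)%N -> T n = T m + \sum_(i <- A n | i \notin A m) normc (a i).
    by move=> le_mn; exact: (big_uniq_subset _ _ _ _ predT _ (uA m) (uA n) (incr _ _ le_mn)).
  have ndT : nondecreasing_seq T.
    by move=> m n /TD ->; rewrite lerDl sumr_ge0 // => *; exact: normc_ge0.
  have cvT : cvgn T by apply: nondecreasing_is_cvgn => //; exists B => _ [N _ <-]; exact: bound.
  have limT := nondecreasing_cvgn_le ndT cvT.
  move/cvgrPdist_lt : (cvT) => /(_ e e0) [N _ hN]; exists N => N' le_NN'.
  have := hN N (leqnn N); have := limT N'; rewrite (TD _ _ le_NN') => h1 /=.
  by rewrite ger0_norm ?subr_ge0 ?limT //; lra.
have totallyF : Filter (@totally I) by have [] := @totally_filter I.
apply/cvg_normcP/cvgrPdist_lt => e e0.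
have e20 : 0 < e / 2 by lra.
have [N1 tailN1] := tail _ e20.
have /cvg_normcP/cvgrPdist_lt/(_ _ e20)[N2 _ limN2] := lim.
pose N := maxn N1 N2.
have tailN N' : (N <= N')%N -> \sum_(i <- A N' | i \notin A N) normc (a i) < e / 2.
  move=> le_NN'; apply: le_lt_trans (tailN1 N' _); last by rewrite (leq_trans _ le_NN') // leq_maxl.
  rewrite big_mkcond [leRHS]big_mkcond; apply: ler_sum => i _.
  case: ifPn => iN; case: ifPn => iN1 //; last exact: normc_ge0.
  by case/negP: iN; apply: incr (negbNE iN1); exact: leq_maxl.
exists [fset i in A N]%fset => // J /= AJ.
have subJ : {subset A N <= enum_fset J}.
  by move=> i iA; apply: (fsubsetP AJ); rewrite inE.
(* The finite set [J] lies in some member of the exhaustion, so the tail bound applies to it. *)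
have [N' JN'] : exists N', {subset enum_fset J <= A N'}.
  elim: (enum_fset J) => [|i s [n1 h1]]; first by exists 0%N.
  have [n2 h2] := cover i; exists (maxn n1 n2) => x; rewrite inE => /predU1P[->|/h1].
    exact: incr (leq_maxr _ _) _ h2.
  exact: incr (leq_maxl _ _) _.
have {}JN' : {subset enum_fset J <= A (maxn N N')}.
  by move=> i /JN'; apply: incr; exact: leq_maxr.
have uJ : uniq (enum_fset J) by exact: fset_uniq.
rewrite -(big_seq_fsetE _ _ predT a) /=.
rewrite sub0r normrN ger0_norm ?normc_ge0 //.
rewrite (big_uniq_subset _ _ _ _ predT _ (uA N) uJ subJ) /= addrAC.
apply: le_lt_trans (le_normcD _ _) _.
have h1 := limN2 N (leq_maxr _ _).
rewrite /= sub0r normrN ger0_norm ?normc_ge0 // in h1.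
have h2 := tailN (maxn N N') (leq_maxl _ _).
have h3 : normc (\sum_(i <- enum_fset J | i \notin A N) a i) <=
    \sum_(i <- A (maxn N N') | i \notin A N) normc (a i).
  apply: le_trans (normc_sum _ _ _ _ _) _.
  rewrite [leRHS](big_uniq_subset _ _ _ _ _ _ uJ (uA _) JN') lerDl.
  by apply: sumr_ge0 => *; exact: normc_ge0.
lra.
Qed.

End Nets.

(** * Enumeration of chains with bounded first entry *)

Section ChainSums.

(** Each entry bounds the next, so sums over this list unfold as nested levels do. *)
Fixpoint bounded_chains (k n : nat) : seq (seq nat) :=
  if k is k'.+1 then
    [seq s :: c | s <- index_iota 0 n.+1, c <- bounded_chains k' s]
  else [:: [::]].

Lemma mem_bounded_chains (k n : nat) (c : seq nat) :
  (c \in bounded_chains k n) = (size c == k) && path geq n c.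
Proof.
elim: k n c => [|k IH] n c.
  by rewrite /= inE; case: c.
apply/allpairsPdep/idP => /= [[s [c' [sn c'k ->]]]|].
  move: c'k sn; rewrite IH mem_index_iota ltnS => /andP[sc pc] /andP[_ sn].
  by rewrite /= eqSS sc pc andbT.
case: c => [|s c] //=; rewrite eqSS => /and3P[sc sn pc]; exists s, c.
by split; rewrite ?IH ?sc // mem_index_iota ltnS.
Qed.

Lemma bounded_chains_uniq (k n : nat) : uniq (bounded_chains k n).
Proof.
elim: k n => [|k IH] n //.
apply: (@allpairs_uniq_dep _ (fun=> seq nat) _ (fun s c => s :: c) (index_iota 0 n.+1)
  (bounded_chains k)); [exact: iota_uniq|by move=> s _; exact: IH|].
by move=> [s c] [s' c'] _ _ /= [-> ->].
Qed.

Lemma big_bounded_chains (V : nmodType) (k n : nat) (G : seq nat -> V) :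
  \sum_(c <- bounded_chains k.+1 n) G c =
  \sum_(s < n.+1) \sum_(c <- bounded_chains k s) G (nat_of_ord s :: c).
Proof.
rewrite -(big_mkord predT (fun s => \sum_(c <- bounded_chains k s) G (s :: c))).
exact: big_allpairs_dep.
Qed.

End ChainSums.

(** * Chain sums as iterated levels, with absolute bounds *)

Section ChainWeights.
Variables (R : realType) (q : R[i]).
Hypothesis q1 : normc q < 1.
Local Notation rho := (normc q).
Local Notation K := (iqpoch_bound R q).
Local Notation G := (1 + (1 - rho)^-1).
Local Notation K2 := (iqpoch_bound R (q ^+ 2)).

(* e = 0, 1, 2 gives s^2 - s, s^2, s^2 + s. *)
Definition slot_exponent (e s : nat) : nat := s * s.-1 + e * s.

(** The argument [n] is the preceding entry; once the lists are exhausted it is s_k, on which [seed]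
    is evaluated. *)
Fixpoint chain_weight (es : seq nat) (n : nat) (c : seq nat) : R[i] :=
  match es, c with
  | e :: es', s :: c' => q ^+ slot_exponent e s * iqpoch q (n - s) * chain_weight es' s c'
  | _, _ => seed q n
  end.

Definition levels (es : seq nat) : nat -> R[i] :=
  foldr (fun e => level q (fun s => q ^+ slot_exponent e s)) (seed q) es.

Lemma sum_chain_weight (es : seq nat) (n : nat) :
  \sum_(c <- bounded_chains (size es) n) chain_weight es n c = levels es n.
Proof.
elim: es n => [|e es IH] n; first by rewrite big_seq1.
rewrite big_bounded_chains; apply: eq_bigr => s _ /=.
by rewrite -mulr_sumr IH.
Qed.

Let K_ge0 : 0 <= K. Proof. exact: le_trans ler01 (K_ge1 _ _ q1). Qed.

Let q21 : normc (q ^+ 2) < 1.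
Proof. by rewrite normcX exprn_ilt1 ?normc_ge0. Qed.

Let K2_ge0 : 0 <= K2. Proof. exact: le_trans ler01 (K_ge1 _ _ q21). Qed.

Let G_ge0 : 0 <= G.
Proof. by rewrite addr_ge0 // invr_ge0 subr_ge0 ltW. Qed.

Lemma normc_seed_le (n : nat) : normc (seed q n) <= K2.
Proof.
rewrite normcM -[leRHS]mul1r ler_pM ?normc_ge0 ?normc_expr_le1 //.
exact: iqpoch_le.
Qed.

Lemma normc_slot_le (e s : nat) : normc (q ^+ slot_exponent e s) <= rho ^+ s.-1.
Proof.
rewrite normcX; apply: ler_wiXn2l; rewrite ?normc_ge0 ?ltW //.
by rewrite /slot_exponent; case: s => //= s; nia.
Qed.

(** Each index costs at most [K] for 1 / (q)_(n-s) and [G] for the sum of |q|^(s-1); [K2] bounds the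
    seed. *)
Lemma sum_normc_chain_weight_le (es : seq nat) (n : nat) :
  \sum_(c <- bounded_chains (size es) n) normc (chain_weight es n c) <=
  K2 * (K * G) ^+ size es.
Proof.
elim: es n => [|e es IH] n; first by rewrite big_seq1 mulr1 normc_seed_le.
rewrite big_bounded_chains /=.
apply: (@le_trans _ _ (\sum_(s < n.+1) rho ^+ s.-1 * K * (K2 * (K * G) ^+ size es))).
  apply: ler_sum => s _; under eq_bigr do rewrite normcM.
  rewrite -mulr_sumr; apply: ler_pM; last exact: IH.
  - exact: normc_ge0.
  - by apply: sumr_ge0 => c _; exact: normc_ge0.
  - by rewrite normcM ler_pM ?normc_ge0 ?normc_slot_le ?iqpoch_le.
rewrite -!mulr_suml -[leLHS]mulrA [(K * G) ^+ _.+1]exprS.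
have rearrange (a b g x : R) : a * (b * g * x) = g * (b * (a * x)) by ring.
rewrite rearrange.
rewrite ler_wpM2r ?geometric_pred_sum_le ?normc_ge0 //.
by rewrite !mulr_ge0 // exprn_ge0 // mulr_ge0.
Qed.

Lemma normc_levels_le (es : seq nat) (n : nat) :
  normc (levels es n) <= K2 * (K * G) ^+ size es.
Proof.
rewrite -sum_chain_weight; apply: le_trans (normc_sum _ _ _ _ _) _.
exact: sum_normc_chain_weight_le.
Qed.

(* The outermost index carries no factor 1 / (q)_(n-s). *)
Definition head_weight (es c : seq nat) : R[i] :=
  q ^+ slot_exponent (head 0%N es) (head 0%N c) *
  chain_weight (behead es) (head 0%N c) (behead c).

Lemma sum_head_weight (e : nat) (es : seq nat) (n : nat) :
  \sum_(c <- bounded_chains (size es).+1 n) head_weight (e :: es) c =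
  \sum_(s < n.+1) q ^+ slot_exponent e s * levels es s.
Proof.
rewrite big_bounded_chains; apply: eq_bigr => s _.
by rewrite -sum_chain_weight mulr_sumr.
Qed.

Lemma sum_normc_head_weight_le (e : nat) (es : seq nat) (n : nat) :
  \sum_(c <- bounded_chains (size es).+1 n) normc (head_weight (e :: es) c) <=
  G * (K2 * (K * G) ^+ size es).
Proof.
rewrite big_bounded_chains.
apply: (@le_trans _ _ (\sum_(s < n.+1) rho ^+ s.-1 * (K2 * (K * G) ^+ size es))).
  apply: ler_sum => s _; under eq_bigr do rewrite /head_weight /= normcM.
  rewrite -mulr_sumr; apply: ler_pM.
  - exact: normc_ge0.
  - by apply: sumr_ge0 => c _; exact: normc_ge0.
  - exact: normc_slot_le.
  - exact: sum_normc_chain_weight_le.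
rewrite -mulr_suml ler_wpM2r ?geometric_pred_sum_le ?normc_ge0 //.
by rewrite mulr_ge0 // exprn_ge0 // mulr_ge0.
Qed.

(** For fixed s the factor 1 / (q)_(n-s) tends to 1 / (q)_oo, and dominated convergence takes it out
    of the sum; multiplication by (q)_oo then removes it. *)
Lemma level_unweighted_cvg (e : nat) (es : seq nat) (L : R[i]) :
  levels (e :: es) n @[n --> \oo] --> L ->
  \sum_(s < n.+1) q ^+ slot_exponent e s * levels es s @[n --> \oo] --> L * qpoch_inf q q.
Proof.
move=> YL.
pose I := (qpoch_inf q q)^-1; have I0 := qpoch_inf_neq0 _ _ q1.
pose a s := q ^+ slot_exponent e s * levels es s.
pose c := K2 * (K * G) ^+ size es.
have c0 : 0 <= c by rewrite mulr_ge0 // exprn_ge0 // mulr_ge0.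
pose b n s := a s * (iqpoch q (n - s) - I).
have b0 : \sum_(s < n.+1) b n s @[n --> \oo] --> (0 : R[i]).
  have d0 : 0 <= c * (K + K) by rewrite mulr_ge0 // addr_ge0.
  apply: (tannery _ _ (fun s => c * (K + K) * rho ^+ s.-1) (c * (K + K) * G) S).
  - move=> n s; rewrite /b /a !normcM (_ : c * (K + K) * _ = rho ^+ s.-1 * c * (K + K)); last by ring.
    rewrite !ler_pM ?mulr_ge0 ?normc_ge0 ?normc_slot_le ?normc_levels_le //.
    apply: le_trans (le_normcD _ _) _; rewrite normcN lerD ?iqpoch_le //.
    by apply: normc_lim_le (iqpoch_cvg _ _ q1) => m; exact: iqpoch_le.
  - by move=> N; rewrite -mulr_sumr ler_wpM2l // geometric_pred_sum_le ?normc_ge0.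
  - move=> s; rewrite -(mulr0 (a s)); apply: cvgMr_complex.
    rewrite -(subrr I); apply: cvgB_complex; last exact: cvg_cst_complex.
    have sub_oo : (fun n => n - s)%N @ \oo --> \oo.
      by move=> P [N _ hN]; exists (N + s)%N => // n /= le_Nn; apply: hN => /=; lia.
    exact: cvg_comp sub_oo (iqpoch_cvg _ _ q1).
have lim2 : (\sum_(s < n.+1) a s) * I @[n --> \oo] --> L.
  apply: cvg_subr0_complex YL _; apply: (cvg_ext_complex _ _ _ _ b0) => n.
  rewrite mulr_suml /= /level -sumrB; apply: eq_bigr => s _.
  by rewrite /b /a; ring.
rewrite [L * _]mulrC.
apply: (cvg_ext_complex _ _ _ _ (cvgMr_complex _ _ _ (qpoch_inf q q) _ _ lim2)) => n.
by rewrite mulrCA mulfV // mulr1.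
Qed.

End ChainWeights.

(** * The summand of the theorem as a product of slot weights *)

Section ChainTerm.
Variables (R : realType) (q : R[i]).
(** Listed from the outermost index s_1; the additional s_k of the exponent is carried by [seed]. *)
Definition slots (j p r : nat) : seq nat := nseq j 0%N ++ nseq p 1%N ++ nseq r 2%N.

Lemma size_slots (j p r : nat) : size (slots j p r) = (j + p + r)%N.
Proof. by rewrite !size_cat !size_nseq addnA. Qed.

Lemma nth_slots (j p r i : nat) : (i < j + p + r)%N ->
  nth 0%N (slots j p r) i = if (i < j)%N then 0%N else if (i < j + p)%N then 1%N else 2%N.
Proof.
move=> lt_i; rewrite !nth_cat !nth_nseq !size_nseq.
case: ltnP => // le_ji; rewrite ltn_subLR //.
by case: ltnP => // le_jpi; rewrite ifT //; lia.
Qed.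

Lemma chain_weightE (es c : seq nat) (n : nat) : size es = size c ->
  chain_weight R q es n c =
  q ^+ (\sum_(i < size c) slot_exponent (nth 0%N es i) (nth 0%N c i)) *
  (\prod_(i < size c) iqpoch q (nth 0%N (n :: c) i - nth 0%N c i)) *
  seed q (last n c).
Proof.
elim: c es n => [|s c IH] [|e es] n //=; first by rewrite !big_ord0 !mul1r.
by case=> /IH ->; rewrite !big_ord_recl /= exprD; ring.
Qed.

Lemma head_weightE (es c : seq nat) : size es = size c -> (0 < size c)%N ->
  head_weight R q es c =
  q ^+ (\sum_(i < size c) slot_exponent (nth 0%N es i) (nth 0%N c i)) *
  (\prod_(i < (size c).-1) iqpoch q (nth 0%N c i - nth 0%N c i.+1)) *
  seed q (last 0%N c).
Proof.
case: es c => [|e es] [|s c] //= [ec] _.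
by rewrite /head_weight /= chain_weightE // big_ord_recl /= exprD; ring.
Qed.

Lemma exponentE (k j r : nat) (t : chain k) : (j + r <= k)%N -> (0 < k)%N ->
  exponent j r t =
  (\sum_(i < k) slot_exponent (nth 0%N (slots j (k - (j + r)) r) i) (nth 0%N (val (val t)) i)
   + nth 0%N (val (val t)) k.-1)%N.
Proof.
move=> jrk k0; rewrite /exponent /entry.
set c := val (val t).
rewrite !big_add1 !big_mkord /=.
rewrite (big_nat_widenl _ 0) // big_mkord.
rewrite (big_ord_widen k (nth 0%N c)); last by lia.
rewrite [X in (_ - X)%N]big_mkcond [X in (_ + X + _ - _)%N]big_mkcond /=.
rewrite -big_split /=.
set l := nth 0%N c k.-1.
set J := (\sum_(i < k) (if (i < j)%N then _ else _))%N.
(* Adding the subtracted sum [J] to the slot exponents lets it cancel exactly, without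
   truncation. *)
have -> : (\sum_(i < k) (nth 0 c i ^ 2 + (if (k - r <= i)%N then nth 0 c i else 0)) =
   \sum_(i < k) slot_exponent (nth 0 (slots j (k - (j + r)) r) i) (nth 0 c i) + J)%N.
  rewrite /J -big_split /=; apply: eq_bigr => i _; have lt_ik := ltn_ord i.
  rewrite nth_slots /slot_exponent; last by lia.
  case: (nth 0%N c i) => [|x]; do 3?case: leqP => ? //=; rewrite -?mulnn; nia.
by rewrite addnAC addnK.
Qed.

Lemma levels_slots (j p r n : nat) :
  levels R q (slots j p r) n =
  iter j (level q (fun s => q ^+ (s * s.-1)))
    (iter p (level q (fun s => q ^+ (s * s)))
      (iter r (level q (fun s => q ^+ (s * s.+1))) (seed q))) n.
Proof.
have lev e (w : nat -> nat) a Z : (forall s, slot_exponent e s = w s) ->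
    foldr (fun e => level q (fun s => q ^+ slot_exponent e s)) Z (nseq a e) =
    iter a (level q (fun s => q ^+ w s)) Z.
  move=> ew; elim: a => //= a ->; congr (level q _ _).
  by apply/funext => s; rewrite ew.
rewrite /levels /slots !foldr_cat.
rewrite (lev 2%N (fun s => s * s.+1)%N) => [|[|s]]; rewrite /slot_exponent /=; try lia.
rewrite (lev 1%N (fun s => s * s)%N) => [|[|s]]; rewrite /slot_exponent /=; try lia.
by rewrite (lev 0%N (fun s => s * s.-1)%N) // => s; rewrite /slot_exponent addn0.
Qed.

Hypothesis q1 : normc q < 1.

Lemma chain_term_head_weight (k j r : nat) (t : chain k) : (j + r <= k)%N -> (0 < k)%N ->
  chain_term q j r t = head_weight R q (slots j (k - (j + r)) r) (val (val t)).
Proof.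
move=> jrk k0.
have sc : size (val (val t)) = k by rewrite size_tuple.
rewrite head_weightE ?size_slots ?sc //; last by lia.
rewrite /chain_term exponentE // exprD -nth_last sc /seed /entry.
set c := val (val t).
rewrite qpochE; last by rewrite normcX exprn_ilt1 ?normc_ge0.
rewrite big_add1 big_mkord.
rewrite (eq_bigr (fun i : 'I_k.-1 => (iqpoch q (nth 0%N c i - nth 0%N c i.+1))^-1)); last first.
  by move=> i _; rewrite qpochE.
rewrite prodfV invfM !invrK; ring.
Qed.

End ChainTerm.

(** * Exhaustion of the type of chains by finite boxes *)

Section Enumeration.
Variable k : nat.

Definition chain_of_seq (c : seq nat) : option (chain k) :=
  obind (insub : k.-tuple nat -> option (chain k)) (insub c : option (k.-tuple nat)).

Lemma chain_of_seqK : ocancel chain_of_seq (fun t : chain k => val (val t)).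
Proof.
move=> c; rewrite /chain_of_seq; case: insubP => //= t _ <-.
by case: insubP => //= u _ ->.
Qed.

Definition chain_box (n : nat) : seq (chain k) := pmap chain_of_seq (bounded_chains k n).

(** [pmap] discards nothing, since every listed sequence is sorted and has length k. *)
Lemma map_chain_box (n : nat) : [seq val (val t) | t <- chain_box n] = bounded_chains k n.
Proof.
rewrite /chain_box (pmap_filter chain_of_seqK); apply/all_filterP/allP => c.
rewrite mem_bounded_chains => /andP[sc pc]; rewrite /chain_of_seq.
rewrite (insubT (fun c : seq nat => size c == k) sc) /= insubT //=.
exact: path_sorted pc.
Qed.

Lemma big_chain_box (V : nmodType) (n : nat) (F : seq nat -> V) :
  \sum_(t <- chain_box n) F (val (val t)) = \sum_(c <- bounded_chains k n) F c.
Proof. by rewrite -map_chain_box big_map. Qed.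

Lemma chain_box_uniq (n : nat) : uniq (chain_box n).
Proof.
by apply: (@map_uniq _ _ (fun t : chain k => val (val t))); rewrite map_chain_box bounded_chains_uniq.
Qed.

Lemma mem_chain_box (n : nat) (t : chain k) : (t \in chain_box n) = path geq n (val (val t)).
Proof.
rewrite -(mem_map (f := fun t : chain k => val (val t))); last by move=> u v /val_inj/val_inj.
by rewrite map_chain_box mem_bounded_chains size_tuple eqxx.
Qed.

Lemma chain_box_mono (m n : nat) : (m <= n)%N -> {subset chain_box m <= chain_box n}.
Proof.
move=> le_mn t; rewrite !mem_chain_box; case: (val (val t)) => //= s c /andP[le_sm ->].
by rewrite (leq_trans le_sm).
Qed.

Lemma chain_box_cover (t : chain k) : exists n, t \in chain_box n.
Proof.
case: t => t st; exists (head 0%N (val t)); rewrite mem_chain_box /=.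
by case: (tval t) st => //= s c ->; rewrite leqnn.
Qed.

End Enumeration.

(** * Evaluation of the full sum over chains *)

Theorem theorem1p9 (R : realType) (q : R[i]) (hq : `|q| < 1)
    (j r k : nat) (hk : (1 <= k)%N) (hjrk : (j + r <= k)%N) :
  partial_sum (fun s : chain k => chain_term q j r s) @ totally -->
  (1 / (1 + q) *
   \sum_(0 <= s < j.+1)
     (qpoch_infs [:: q ^+ (2 * k + 2);
                     q ^+ (k + 2 + j - (r + 2 * s));
                     q ^+ (k + r + 2 * s - j)] (q ^+ (2 * k + 2))
        / qpoch_inf q q
      + q * (qpoch_infs [:: q ^+ (2 * k + 2);
                            q ^+ (k + j - (r + 2 * s));
                            q ^+ (k + 2 + r + 2 * s - j)] (q ^+ (2 * k + 2))
        / qpoch_inf q q)) : R[i]).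
Proof.
have q1 : normc q < 1 by rewrite -ltcR; exact: hq.
have q1' : 1 + q != 0.
  apply: contraTneq q1 => /eqP; rewrite addrC addr_eq0 => /eqP ->.
  by rewrite normcN normc1 ltxx.
pose p := (k - (j + r))%N.
have kE : (k = r + j + p)%N by rewrite /p; lia.
have I0 := qpoch_inf_neq0 _ _ q1.
(* As k >= 1, there is an outermost slot to separate from the others. *)
have [e [es slotsE]] : exists e es, slots j p r = e :: es.
  case: (slots j p r) (size_slots j p r) => [|e es _]; last by exists e, es.
  by move=> /=; lia.
have ses : (size es).+1 = k.
  by have := size_slots j p r; rewrite slotsE /=; lia.
have termE (t : chain k) : chain_term q j r t = head_weight R q (e :: es) (val (val t)).
  by rewrite -slotsE chain_term_head_weight.
pose S := \sum_(s < j.+1)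
    (qpoch_infs [:: q ^+ (2 * k + 2); q ^+ (k + 2 + j - (r + 2 * s)); q ^+ (k + r + 2 * s - j)]
       (q ^+ (2 * k + 2)) +
     q * qpoch_infs [:: q ^+ (2 * k + 2); q ^+ (k + j - (r + 2 * s)); q ^+ (k + 2 + r + 2 * s - j)]
       (q ^+ (2 * k + 2))).
pose I := (qpoch_inf q q)^-1.
have limL : levels R q (e :: es) n @[n --> \oo] --> (1 + q)^-1 * S * (I * I).
  have limS : (\sum_(m < n.+1) limit_coef R q j p r m) * (I * I) @[n --> \oo] -->
      (1 + q)^-1 * S * (I * I).
    exact: cvgM_complex (limit_coef_sum_cvg _ _ q1 _ _ _ _ kE) (cvg_cst_complex _ _).
  apply: cvg_subr0_complex limS _.
  rewrite -[X in _ --> X](mulr0 (-1)); apply: (cvg_ext_complex _ _ _ _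
    (cvgMr_complex _ _ _ (-1) _ _ (iter_seed_sub_cvg0 _ _ q1 j p r q1'))) => n.
  by rewrite -slotsE levels_slots // mulN1r opprB.
(* The summand has no factor 1 / (q)_(n-s_1); dropping it multiplies the limit by (q)_oo and cancels
   one of the two factors [I]. *)
have lim := level_unweighted_cvg _ _ q1 _ _ _ limL.
apply: (cvg_totally _ _ _ (chain_box k)
   ((1 + (1 - normc q)^-1) * (iqpoch_bound R (q ^+ 2) *
     (iqpoch_bound R q * (1 + (1 - normc q)^-1)) ^+ size es))).
- exact: chain_box_uniq.
- exact: chain_box_mono.
- exact: chain_box_cover.
- move=> n; under eq_bigr do rewrite termE.
  rewrite (big_chain_box _ _ _ (fun c => normc (head_weight R q (e :: es) c))).
  rewrite -[in bounded_chains k _]ses; exact: sum_normc_head_weight_le.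
have limE : (1 + q)^-1 * S * (I * I) * qpoch_inf q q =
  1 / (1 + q) *
   \sum_(0 <= s < j.+1)
     (qpoch_infs [:: q ^+ (2 * k + 2);
                     q ^+ (k + 2 + j - (r + 2 * s));
                     q ^+ (k + r + 2 * s - j)] (q ^+ (2 * k + 2))
        / qpoch_inf q q
      + q * (qpoch_infs [:: q ^+ (2 * k + 2);
                            q ^+ (k + j - (r + 2 * s));
                            q ^+ (k + 2 + r + 2 * s - j)] (q ^+ (2 * k + 2))
        / qpoch_inf q q)).
  rewrite big_mkord mul1r -!mulrA; congr (_ * _).
  rewrite /I mulVf // mulr1 /S mulr_suml; apply: eq_bigr => s _.
  by rewrite mulrDl mulrA.
rewrite -limE; apply: (cvg_ext_complex _ _ _ _ lim) => n.
rewrite -sum_head_weight ses -big_chain_box.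
by apply: eq_bigr => t _; rewrite termE.
Qed.
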